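(* Let $I=(i_1<\dots<i_r)$ be an increasing tuple in $\{1,\dots,n\}$ and let $I'$ be its increasing complement in $\{1,\dots,n\}$. Let $N=\mathrm{intc}(I)$ be the column intertwining order of $I$ in $\{1,\dots,n\}$. Then in $\mathcal O_q(M_n(k))$ $$[r+1\dots n,I'][1\dots r,I]=[1\dots r,I][r+1\dots n,I']+\sum_{i=1}^{N}(-1)^i(q^{-1}-q)^i\sum_{(R,R')\in C_i^I}(-q)^{-l(R)-l(R')}[1\dots r,R_{ord}][r+1\dots n,R'_{ord}],$$ and this is a commutation relation between the quantum minors $[r+1\dots n,I']$ and $[1\dots r,I]$, in the sense defined in the context.
   Context: Let $k$ be a field, $q$ an indeterminate, $k_q=k[q,q^{-1}]$. $\mathcal O_q(M_n(k))$ is the $k_q$-algebra generated by $x_{ij}$, $1\le i,j\le n$, with relations: $x_{ij}x_{ik}=q^{-1}x_{ik}x_{ij}$ and $x_{ji}x_{ki}=q^{-1}x_{ki}x_{ji}$ for $j<k$; $x_{ij}x_{kl}=x_{kl}x_{ij}$ if $i<k,\ j>l$ or $i>k,\ j<l$; $x_{ij}x_{kl}-x_{kl}x_{ij}=(q^{-1}-q)x_{kj}x_{il}$ if $i<k,\ j<l$. Quantum minors: for increasing tuples $A=(a_1<\dots<a_p)$, $B=(b_1<\dots<b_p)$, $[A,B]=\sum_{\sigma\in S_p}(-q)^{-l(\sigma)}x_{a_1b_{\sigma(1)}}\cdots x_{a_pb_{\sigma(p)}}$, with $l(\sigma)$ the number of inversions. For a tuple $S$ of distinct integers, $S_{ord}$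 is its increasing rearrangement and $l(S)$ is its number of inversions. Commutation relation: for increasing tuples with $(I,J)<(K,L)$ lexicographically, a commutation relation between $[I,J]$ and $[K,L]$ is an identity $f(q)[K,L][I,J]-g(q)[I,J][K,L]-\sum_{(I_z,J_z)<(K,L)}b_z[I_z,J_z][K_z,L_z]=0$ with $f(q),g(q),b_z\in k_q$, $f(0)=g(0)=1$ (here $f=g=1$). Standard column tower: let $J=(j_1<\dots<j_r)$ in $\{1,\dots,n\}$, $J\ne(n-r+1,\dots,n)$. Put $j_{r+1}=n+1$ and let $p$ be the largest index in $\{1,\dots,r\}$ with $j_{p+1}-j_p>1$; the standard column transposition of $J$ is $\sigma_J=(j_p,\,j_p+1)$. Applying successively the standard transpositions one gets the standard column tower $I=I_N<I_{N-1}<\dots<I_0=(n-r+1,\dots,n)$, with $I_{s-1}=\sigma_s(I_s)$, $\sigma_s=\sigma_{I_s}$; its length $N=\mathrm{intc}(I)$ is the column intertwining order of $I$. The lists $C_i^{I_s}$ (finite lists, with multiplicity, of pairs $(R,R')$ of tuples of distinct, not necessarily increasing, integers): $C_0^{I_0}$ consists of the single pair $(I_0,I_0')$, where $I_0'$ is the increasing complement of $I_0$; $C_i^{I_s}$ is empty if $i<0$ or $i>s$; for $1\le s\le N$ and $0\le i\le s$, $C_i^{I_s}$ is the concatenation of $C_{i-1}^{I_{s-1}}$ with the members of $\phi_{i-1}^{I_{s-1}}$ removed, and of $\sigma_s(C_i^{I_{s-1}})$. Here $\sigma_s$ acts by applying the transposition to every entry of $R$ and $R'$ (with no reordering), and,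 if $\sigma_s=(z,z+1)$, $\phi_{i-1}^{I_{s-1}}$ is the sublist of $C_{i-1}^{I_{s-1}}$ of those $(R,R')$ for which $z$ appears before $z+1$ in the concatenated tuple $(R,R')$. Finally $C_i^I:=C_i^{I_N}$. Sums over $C_i^I$ count multiplicity. *)

(* Defs.v *)
From HB Require Import structures.
From mathcomp Require Import all_boot all_order all_algebra.
From mathcomp Require Import perm boolp.
From mathcomp Require Import finmap monalg zify.

Set Implicit Arguments.
Unset Strict Implicit.
Unset Printing Implicit Defensive.

Import Order.TTheory GRing.Theory.

Local Open Scope ring_scope.
Local Open Scope quotient_scope.

(** * The Laurent polynomial ring [k[q, q^-1]] *)

Local Notation "x %:F" := (tofrac x) : ring_scope.

Section Laurent.
Variable k : fieldType.

(* Laurent polynomials are the rational functions whose denominator is a power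
   of the indeterminate. *)
Definition laurent : pred {fraction {poly k}} :=
  fun f => `[< exists (m : nat) (p : {poly k}), f * ('X^m)%:F = p%:F >].

Record kq : predArgType :=
  LaurentPoly { kq_val : {fraction {poly k}}; _ : kq_val \in laurent }.

HB.instance Definition _ := [isSub for kq_val].
HB.instance Definition _ := [Choice of kq by <:].

Lemma laurent_subring_closed : subring_closed laurent.
Proof.
split=> [|f g|f g].
- by apply/asboolP; exists 0%N, 1; rewrite expr0 mul1r.
- move=> /asboolP[m [p fp]] /asboolP[l [s gs]]; apply/asboolP.
  exists (m + l)%N, (p * 'X^l - s * 'X^m).
  rewrite exprD !(tofracB, tofracM) -fp -gs mulrBl mulrA; congr (_ - _).
  by rewrite mulrA mulrAC.
- move=> /asboolP[m [p fp]] /asboolP[l [s gs]]; apply/asboolP.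
  by exists (m + l)%N, (p * s); rewrite exprD !tofracM -fp -gs mulrACA.
Qed.

HB.instance Definition _ :=
  GRing.SubChoice_isSubComNzRing.Build {fraction {poly k}} laurent kq
    laurent_subring_closed.

Definition kq_unit : pred kq :=
  fun f => (val f != 0) && ((val f)^-1 \in laurent).

Definition kq_inv (f : kq) : kq := insubd f (val f)^-1.

Lemma kq_mulVf : {in kq_unit, left_inverse 1 kq_inv *%R}.
Proof.
move=> f /andP[f0 fl]; apply: val_inj.
by rewrite rmorphM /= insubdK // mulVf // rmorph1.
Qed.

Lemma kq_unitP (f g : kq) : g * f = 1 -> kq_unit f.
Proof.
move=> /(congr1 val); rewrite rmorphM rmorph1 /= => gf.
have f0 : val f != 0.
  by apply: contra_eq_neq gf => ->; rewrite mulr0 eq_sym oner_eq0.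
rewrite /kq_unit f0 /=; suff -> : (val f)^-1 = val g by exact: valP.
by apply: (mulIf f0); rewrite gf mulVf.
Qed.

Lemma kq_inv_out : {in [predC kq_unit], kq_inv =1 id}.
Proof.
move=> f; rewrite !inE /kq_unit negb_and negbK => /orP[/eqP f0|fl].
  by apply: val_inj; rewrite /kq_inv f0 invr0 insubdK // -f0; exact: valP.
by rewrite /kq_inv /insubd insubN.
Qed.

HB.instance Definition _ :=
  GRing.ComNzRing_hasMulInverse.Build kq kq_mulVf kq_unitP kq_inv_out.

Lemma laurentX : 'X%:F \in laurent.
Proof. by apply/asboolP; exists 0%N, 'X; rewrite expr0 mulr1. Qed.

Definition q : kq := LaurentPoly laurentX.

Lemma q_unit : q \is a GRing.unit.
Proof.
apply/andP; split; first by rewrite /= tofrac_eq0 polyX_eq0.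
apply/asboolP; exists 1%N, 1.
by rewrite /= expr1 mulVf // tofrac_eq0 polyX_eq0.
Qed.

(* [f(0) = c]; this entails that [f] has no pole at [0], i.e. lies in [k[q]]. *)
Definition value_at0 (f : kq) (c : k) : Prop :=
  exists2 p : {poly k}, val f = p%:F & p.[0] = c.

End Laurent.

Arguments q {k}.

(** * Quotient of an algebra by the two-sided ideal generated by relators *)

Section Presented.
Variables (K : nzRingType) (A : lalgType K) (rel : A -> Prop).

Definition gen_ideal : pred A := fun u =>
  `[< exists s : seq (A * A * A),
        (forall t, t \in s -> rel t.1.2) /\
        u = \sum_(t <- s) t.1.1 * t.1.2 * t.2 >].

Lemma gen_idealMl u v : v \in gen_ideal -> u * v \in gen_ideal.
Proof.
move=> /asboolP[s [sr ->]]; apply/asboolP.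
exists [seq (u * t.1.1, t.1.2, t.2) | t <- s]; split=> [_ /mapP[t ts ->]|].
  exact: (sr t ts).
by rewrite big_map mulr_sumr; apply: eq_bigr => t _ /=; rewrite !mulrA.
Qed.

Lemma gen_idealMr u v : v \in gen_ideal -> v * u \in gen_ideal.
Proof.
move=> /asboolP[s [sr ->]]; apply/asboolP.
exists [seq (t.1.1, t.1.2, t.2 * u) | t <- s]; split=> [_ /mapP[t ts ->]|].
  exact: (sr t ts).
by rewrite big_map mulr_suml; apply: eq_bigr => t _ /=; rewrite !mulrA.
Qed.

Lemma gen_ideal_zmod_closed : zmod_closed gen_ideal.
Proof.
split=> [|u v]; first by apply/asboolP; exists [::]; rewrite big_nil.
move=> uI /(gen_idealMl (-1)); rewrite mulN1r.
move: uI => /asboolP[s [sr ->]] /asboolP[s' [sr' ->]]; apply/asboolP.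
exists (s ++ s'); split; last by rewrite big_cat.
by move=> t; rewrite mem_cat => /orP[/sr|/sr'].
Qed.

HB.instance Definition _ :=
  GRing.isZmodClosed.Build A gen_ideal gen_ideal_zmod_closed.

Lemma gen_ideal_rel u : rel u -> u \in gen_ideal.
Proof.
move=> ru; apply/asboolP; exists [:: (1, u, 1)].
by split=> [t|]; rewrite ?big_seq1 ?mul1r ?mulr1 // inE => /eqP->.
Qed.

Hypothesis ideal1 : 1 \notin gen_ideal.

(* The argument [1 \notin gen_ideal] does not affect the carrier; it is used by
   the [nzRingType] instance. *)
Definition presented & 1 \notin gen_ideal : Type := 
  {ideal_quot (GRing.ZmodClosed.clone A gen_ideal _)}.
Local Notation Q := (presented ideal1).

HB.instance Definition _ := GRing.Zmodule.on Q.
HB.instance Definition _ := ZmodQuotient.on Q.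

Definition pr_one : Q := lift_cst Q 1.
Definition pr_mul : Q -> Q -> Q := lift_op2 Q *%R.
Definition pr_scale (c : K) : Q -> Q := lift_op1 Q ( *:%R c).

Lemma pr_equiv u v : (\pi_Q u == \pi_Q v) = (u - v \in gen_ideal).
Proof. exact/esym/Quotient.idealrBE. Qed.

Canonical pi_pr_one := PiConst pr_one.

Lemma pi_pr_mul : {morph \pi_Q : u v / u * v >-> pr_mul u v}.
Proof.
move=> u v; unlock pr_mul; apply/eqP; rewrite pr_equiv.
have E w : w - repr (\pi_Q w) \in gen_ideal by rewrite -pr_equiv reprK.
rewrite -(subrKA (u * repr (\pi_Q v))) -mulrBr -mulrBl.
by apply: rpredD; [exact: gen_idealMl | exact: gen_idealMr].
Qed.
Canonical pi_pr_mul_morph := PiMorph2 pi_pr_mul.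

Lemma pi_pr_scale c : {morph \pi_Q : u / c *: u >-> pr_scale c u}.
Proof.
move=> u; unlock pr_scale; apply/eqP; rewrite pr_equiv -scalerBr.
by rewrite -[_ - _]mul1r scalerAl gen_idealMl // -pr_equiv reprK.
Qed.
Canonical pi_pr_scale_morph c := PiMorph1 (pi_pr_scale c).

Lemma pr_mulA : associative pr_mul.
Proof. by move=> x y z; rewrite -[x]reprK -[y]reprK -[z]reprK !piE mulrA. Qed.

Lemma pr_mul1 : left_id pr_one pr_mul.
Proof. by move=> x; rewrite -[x]reprK !piE mul1r. Qed.

Lemma pr_mulr1 : right_id pr_one pr_mul.
Proof. by move=> x; rewrite -[x]reprK !piE mulr1. Qed.

Lemma pr_mulDl : left_distributive pr_mul +%R.
Proof. by move=> x y z; rewrite -[x]reprK -[y]reprK -[z]reprK !piE mulrDl. Qed.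

Lemma pr_mulDr : right_distributive pr_mul +%R.
Proof. by move=> x y z; rewrite -[x]reprK -[y]reprK -[z]reprK !piE mulrDr. Qed.

Lemma pr_oner_neq0 : pr_one != 0.
Proof. by rewrite piE /Quotient.equiv subr0. Qed.

HB.instance Definition _ := GRing.Zmodule_isNzRing.Build Q
  pr_mulA pr_mul1 pr_mulr1 pr_mulDl pr_mulDr pr_oner_neq0.

Lemma pr_scaleA a b x : pr_scale a (pr_scale b x) = pr_scale (a * b) x.
Proof. by rewrite -[x]reprK !piE scalerA. Qed.

Lemma pr_scale1 : left_id 1 pr_scale.
Proof. by move=> x; rewrite -[x]reprK !piE scale1r. Qed.

Lemma pr_scaleDr : right_distributive pr_scale +%R.
Proof. by move=> c x y; rewrite -[x]reprK -[y]reprK !piE scalerDr. Qed.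

Lemma pr_scaleDl x : {morph pr_scale^~ x : a b / a + b}.
Proof. by move=> a b; rewrite -[x]reprK !piE scalerDl. Qed.

HB.instance Definition _ := GRing.Zmodule_isLmodule.Build K Q
  pr_scaleA pr_scale1 pr_scaleDr pr_scaleDl.

Lemma pi_prZ c u : \pi_Q (c *: u) = c *: \pi_Q u.
Proof. exact: pi_pr_scale. Qed.

Lemma pi_prM u v : \pi_Q (u * v) = \pi_Q u * \pi_Q v.
Proof. exact: pi_pr_mul. Qed.

Lemma pr_scaleAl (c : K) (x y : Q) : c *: (x * y) = (c *: x) * y.
Proof. by rewrite -[x]reprK -[y]reprK -!(pi_prZ, pi_prM) scalerAl. Qed.

HB.instance Definition _ := GRing.Lmodule_isLalgebra.Build K Q pr_scaleAl.

Lemma pr_scaleAr :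
  (forall (c : K) (u v : A), c *: (u * v) = u * (c *: v)) ->
  forall (c : K) (x y : Q), c *: (x * y) = x * (c *: y).
Proof.
by move=> Ar c x y; rewrite -[x]reprK -[y]reprK -!(pi_prZ, pi_prM) Ar.
Qed.

End Presented.

(** * The quantum matrix algebra *)

Definition idx (n : nat) : predArgType := {i : nat | (0 < i <= n)%N}.

Lemma malg_scaleAr (K : monomType) (R : comNzRingType) (c : R)
  (u v : {malg R[K]}) : c *: (u * v) = u * (c *: v).
Proof.
apply/malgP => m; rewrite mcoeffZ mcoeffMl.
rewrite (mcoeffMlw _ (fsubset_refl _) (msuppZ_le c v)) mulr_sumr.
apply: eq_bigr => a _; rewrite mulr_sumr; apply: eq_bigr => b _.
by rewrite mcoeffZ mulrnAr mulrCA.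
Qed.

Section QuantumMatrices.
Variables (k : fieldType) (n : nat).

Section Relators.
Variables (A : lalgType (kq k)) (X : idx n -> idx n -> A).

Inductive relator : A -> Prop :=
| rel_row (i j l : idx n) of (val j < val l)%N :
    relator (X i j * X i l - q^-1 *: (X i l * X i j))
| rel_col (i j l : idx n) of (val j < val l)%N :
    relator (X j i * X l i - q^-1 *: (X l i * X j i))
| rel_comm (i j a l : idx n)
    of (val i < val a)%N && (val j > val l)%N
       || (val i > val a)%N && (val j < val l)%N :
    relator (X i j * X a l - X a l * X i j)
| rel_cross (i j a l : idx n) of (val i < val a)%N & (val j < val l)%N :
    relator (X i j * X a l - X a l * X i j - (q^-1 - q) *: (X a j * X i l)).

(* The relators have no constant term, so that the quotient is not trivial. *)
Lemma relator1_subproof (f : {rmorphism A -> kq k}) :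
  (forall c u, f (c *: u) = c * f u) -> (forall i j, f (X i j) = 0) ->
  1 \notin gen_ideal relator.
Proof.
move=> fZ fX; have f0 u : relator u -> f u = 0.
  by case=> *; rewrite !rmorphB ?fZ !rmorphM /= !fX !mul0r ?mulr0 !subr0.
apply/negP => /asboolP[s [sr /(congr1 f)]].
rewrite rmorph1 raddf_sum big_seq big1 => [/eqP|t /sr/f0 t0].
  by rewrite oner_eq0.
by rewrite /= !rmorphM t0 mulr0 mul0r.
Qed.

End Relators.

(* The free associative [k[q, q^-1]]-algebra on the letters [X i j]. *)
Definition freeM : lalgType (kq k) :=
  {malg (kq k)[{fmonom (idx n * idx n)%type}]}.

Definition X (i j : idx n) : freeM := << fmu (i, j) >>.

Lemma relator1 : 1 \notin gen_ideal (relator X).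
Proof.
pose one := @monalg.one {fmonom (idx n * idx n)%type}.
apply: (@relator1_subproof _ _ (mcoeff one)).
  by move=> c u; rewrite /= mcoeffZ.
by move=> i j; rewrite /= mcoeffU1 fmP fm1 fmU.
Qed.

Definition OqM : Type := presented relator1.

HB.instance Definition _ := GRing.Lalgebra.on OqM.

Lemma OqM_scaleAr (c : kq k) (u v : OqM) : c *: (u * v) = u * (c *: v).
Proof. by apply: pr_scaleAr; exact: malg_scaleAr. Qed.

HB.instance Definition _ :=
  GRing.Lalgebra_isAlgebra.Build (kq k) OqM OqM_scaleAr.

(* The generator [x_ij], with indices counted from 1; the value is irrelevant
   (and set to 0) when an index is not in [1..n]. *)
Definition x (i j : nat) : OqM :=
  if (insub i, insub j) is (Some a, Some b)
  then \pi_(presented relator1) (X a b) else 0.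

End QuantumMatrices.

(** * Tuples of integers and quantum minors *)

Definition increasing_in (n : nat) (A : seq nat) : bool :=
  sorted ltn A && all (fun a => 0 < a <= n)%N A.

(* The number [l(S)] of inversions of [S]. *)
Definition ninv (S : seq nat) : nat :=
  (\sum_(0 <= b < size S) \sum_(0 <= a < b) (nth 0 S b < nth 0 S a))%N.

Definition reorder (S : seq nat) : seq nat := sort leq S.

Definition complement (n : nat) (A : seq nat) : seq nat :=
  [seq a <- iota 1 n | a \notin A].

Definition perm_seq (p : nat) (s : 'S_p) : seq nat :=
  [seq val (s i) | i <- enum 'I_p].

(* [A] and [B] are meant to have the same size. *)
Definition minor (k : fieldType) (n : nat) (A B : seq nat) : OqM k n :=
  \sum_(s : 'S_(size A)) (- q) ^- ninv (perm_seq s) *: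
    \prod_(i < size A) x k n (nth 0 A i) (nth 0 B (s i)).

(** * Commutation relations *)

Definition minor_idx := (seqlexi nat *l seqlexi nat)%type.

Definition is_minor_idx (n : nat) (AB : minor_idx) : Prop :=
  [/\ increasing_in n AB.1, increasing_in n AB.2 & size AB.1 = size AB.2].

(* The identity
     f [KL] [IJ] - g [IJ] [KL] - \sum_z b_z [I_z J_z] [K_z L_z] = 0,
   the list [bs] having the entries [(b_z, ((I_z, J_z), (K_z, L_z)))]. *)
Definition commutation_relation (k : fieldType) (n : nat) (f g : kq k)
    (IJ KL : minor_idx) (bs : seq (kq k * (minor_idx * minor_idx))) : Prop :=
  let M (AB : minor_idx) := minor k n AB.1 AB.2 in
  [/\ is_minor_idx n IJ /\ is_minor_idx n KL,
      (IJ < KL)%O,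
      value_at0 f 1 /\ value_at0 g 1,
      forall b, b \in bs ->
        [/\ is_minor_idx n b.2.1, is_minor_idx n b.2.2 & (b.2.1 < KL)%O]
    & f *: (M KL * M IJ) - g *: (M IJ * M KL)
        - \sum_(b <- bs) b.1 *: (M b.2.1 * M b.2.2) = 0].

(** * The standard column tower *)

Definition top_tuple (n r : nat) : seq nat := iota (n - r).+1 r.

(* The transposition [(z, z + 1)]. *)
Definition swap (z a : nat) : nat :=
  if a == z then z.+1 else if a == z.+1 then z else a.

(* The entry [j_p] of [J] such that [(j_p, j_p + 1)] is the standard column
   transposition; positions are counted from 0 here, and the default value of
   [nth] accounts for the convention [j_(r+1) = n + 1]. *)
Definition col_entry (n : nat) (J : seq nat) : nat :=
  let j p := nth n.+1 J p in
  j (last 0 [seq p <- iota 0 (size J) | 1 < j p.+1 - j p])%N.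

Definition col_step (n : nat) (J : seq nat) : seq nat :=
  map (swap (col_entry n J)) J.

(* The length of the tower: the first [m] such that [m] steps lead to
   [(n - r + 1, ..., n)]; the search bound is large enough by [intcP]. *)
Definition intc (n : nat) (J : seq nat) : nat :=
  let top := top_tuple n (size J) in
  find (fun m => iter m (col_step n) J == top) (iota 0 (sumn top).+1).

Section Intc.
Variables (n : nat) (J : seq nat).
Let r := size J.
Let j := nth n.+1 J.

Hypothesis incJ : increasing_in n J.

Let j_r : j r = n.+1.
Proof. by rewrite /j nth_default. Qed.

Let j_bnd i : (i < r)%N -> (0 < j i <= n)%N.
Proof. by case/andP: incJ => _ /all_nthP h ir; exact: h. Qed.

Let jS i : (i < r)%N -> (j i < j i.+1)%N.
Proof.
move=> ir; have [ir1|] := ltnP i.+1 r; last first.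
  by move=> ri; rewrite [j i.+1]nth_default // ltnS; case/andP: (j_bnd ir).
by case/andP: incJ => /(sortedP n.+1) h _; exact: h.
Qed.

Let j_homo i i' : (i < i' <= r)%N -> (j i < j i')%N.
Proof.
case/andP; elim: i' => // i' IH; rewrite ltnS leq_eqVlt => /orP[/eqP->|ii'] ir.
  exact: jS.
exact: ltn_trans (IH ii' (ltnW ir)) (jS ir).
Qed.

Let j_ub i : (i <= r)%N -> (j i + (r - i) <= n.+1)%N.
Proof.
move=> ir; have [m mE] : exists m, m = (r - i)%N by exists (r - i)%N.
elim: m i ir mE => [|m IH] i ir mE.
  have -> : i = r by lia.
  by rewrite j_r; lia.
by have := IH i.+1 ltac:(lia) ltac:(lia); have := @jS i ltac:(lia); lia.
Qed.

Let size_le : (r <= n)%N.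
Proof.
have := @j_ub 0 isT; case: (posnP r) => [->//|r0].
by have := j_bnd r0; lia.
Qed.

Let nth_top i : (i < r)%N -> nth n.+1 (top_tuple n r) i = (n - r + i.+1)%N.
Proof. by move=> ir; rewrite nth_iota // addSn addnS. Qed.

Let gaps := [seq p <- iota 0 r | (1 < j p.+1 - j p)%N].

Let no_gap : gaps = [::] -> J = top_tuple n r.
Proof.
move=> g0; have jE m : (m <= r)%N -> j (r - m) = (n.+1 - m)%N.
  elim: m => [|m IH] mr; first by rewrite !subn0.
  have := IH (ltnW mr); have -> : (r - m = (r - m.+1).+1)%N by lia.
  have : (r - m.+1)%N \notin gaps by rewrite g0.
  rewrite mem_filter mem_iota => h; have := @jS (r - m.+1) ltac:(lia).
  by move: h; lia.
apply: (@eq_from_nth _ n.+1); first by rewrite size_iota.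
move=> i ir; rewrite nth_top // -/(j i).
have := jE (r - i)%N ltac:(lia); rewrite subKn; last exact: ltnW.
by move=> ->; move: (size_le) ir; lia.
Qed.

Lemma col_stepP : J != top_tuple n (size J) ->
  increasing_in n (col_step n J) /\ sumn (col_step n J) = (sumn J).+1.
Proof.
move=> Jtop; have gN0 : gaps != [::] by apply: contraNneq Jtop => /no_gap <-.
pose p := last 0%N gaps.
have : p \in gaps.
  by rewrite /p; case: gaps gN0 => // a s _ /=; rewrite mem_last.
rewrite mem_filter mem_iota /= add0n => /andP[gp pr].
have col_nth i : (i < r)%N -> nth n.+1 (col_step n J) i = (j i + (i == p))%N.
  move=> ir; rewrite (nth_map n.+1) // -/(j i) /swap -[col_entry n J]/(j p).
  case: (ltngtP i p) => ip.
  - have := @j_homo i p ltac:(lia).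
    by case: eqP => [|_]; [lia|]; case: eqP; lia.
  - have : (j p.+1 <= j i)%N.
      have [<-//|/eqP pi] := eqVneq p.+1 i.
      by apply/ltnW/j_homo; lia.
    by case: eqP => [|_]; [lia|]; case: eqP; lia.
  - by rewrite ip eqxx addn1.
have sz : size (col_step n J) = r by rewrite size_map.
split; last first.
  rewrite (sumnE (col_step n J)) (big_nth n.+1) sz.
  under eq_big_nat => i /andP[_ ir] do rewrite col_nth //.
  rewrite big_split /= (sumnE J) -[RHS]addn1; congr addn.
    by rewrite [RHS](big_nth n.+1).
  rewrite big_mkord (bigD1 (Ordinal pr)) //= eqxx big1 // => i.
  by rewrite -val_eqE => /negPf /= ->.
apply/andP; split.
  apply/(sortedP n.+1) => i; rewrite sz => ir.
  rewrite !col_nth //; last exact: ltnW.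
  have := @jS i (ltnW ir); have [->|_] := eqVneq i p; last by lia.
  by lia.
apply/(all_nthP n.+1) => i; rewrite sz => ir; rewrite col_nth //.
have := j_bnd ir; have [->|_] := eqVneq i p; last by lia.
have : (j p.+1 <= n.+1)%N by have := @j_ub p.+1 pr; lia.
by lia.
Qed.

Lemma sumn_top : (sumn J <= sumn (top_tuple n (size J)))%N.
Proof.
rewrite (sumnE J) (sumnE (top_tuple n r)).
rewrite [leqLHS](big_nth n.+1) [leqRHS](big_nth n.+1) size_iota.
rewrite big_nat [leqRHS]big_nat; apply: leq_sum => i /andP[_ ir].
rewrite nth_top // -/(j i); have := @j_ub i (ltnW ir).
by move: size_le ir; lia.
Qed.

End Intc.

Lemma intcP (n : nat) (J : seq nat) : increasing_in n J ->
  iter (intc n J) (col_step n) J = top_tuple n (size J) /\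
  forall m, (m < intc n J)%N ->
    iter m (col_step n) J <> top_tuple n (size J).
Proof.
move=> incJ; set top := top_tuple n (size J).
pose a m := iter m (col_step n) J == top.
have [m mtop am] : exists2 m, (m <= sumn top)%N & a m.
  have [d dE] : exists d, d = (sumn top - sumn J)%N by eexists.
  suff [m mb am] : exists2 m, (m <= sumn top - sumn J)%N & a m.
    by exists m => //; lia.
  rewrite /a /top {a top} in dE *.
  elim: d J incJ dE => [|d IH] L incL dE.
    exists 0%N => //=; apply/negPn/negP => Ltop.
    have [incL' sL] := col_stepP incL Ltop.
    by have := sumn_top incL'; rewrite sL size_map; lia.
  have [/eqP Ltop|Ltop] := boolP (L == top_tuple n (size L)).
    by exists 0%N => //=; apply/eqP.
  have [incL' sL] := col_stepP incL Ltop.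
  have [|m mb am] := IH _ incL'; first by rewrite size_map sL; lia.
  exists m.+1; first by move: mb; rewrite size_map sL; lia.
  by rewrite iterSr; rewrite size_map in am.
have ha : has a (iota 0 (sumn top).+1).
  by apply/hasP; exists m; rewrite ?mem_iota.
have fl := ha; rewrite has_find size_iota in fl.
split=> [|l lN].
  by have /eqP := nth_find 0%N ha; rewrite nth_iota // add0n.
have := before_find 0%N lN; rewrite nth_iota; last exact: ltn_trans lN fl.
by rewrite add0n => /eqP.
Qed.

Definition appears_before (z : nat) (RR : seq nat * seq nat) : bool :=
  let s := RR.1 ++ RR.2 in (index z s < index z.+1 s)%N.

(* [Clist n s J i] is [C_i^J], where [s] is the length of the tower of [J]. *)
Fixpoint Clist (n s : nat) (J : seq nat) (i : nat)
    : seq (seq nat * seq nat) :=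
  if s is s'.+1 then
    let z := col_entry n J in
    let C := Clist n s' (col_step n J) in
    if (s < i)%N then [::] else
    (if i is i'.+1 then [seq RR <- C i' | ~~ appears_before z RR] else [::])
      ++ [seq (map (swap z) RR.1, map (swap z) RR.2) | RR <- C i]
  else if i is 0 then [:: (J, complement n J)] else [::].

Definition Ccol (n : nat) (I : seq nat) (i : nat) : seq (seq nat * seq nat) :=
  Clist n (intc n I) I i.

(* Main.v *)
Require Import Defs.
From mathcomp Require Import all_boot all_order all_algebra.
From mathcomp Require Import perm boolp finmap monalg zify ring.

(** Everything follows from one linear operator [T_z] on the quantum matrix
    algebra for each [z], the action of a Hecke generator on column indices: a
    word in the [x_ij] whose columns are [b], with [z] and [z + 1] occurring
    exactly once in [b], is sent to the word with columns [s_z b], minus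
    [q^-1 - q] times the original word when [z + 1] precedes [z].  This respects
    the defining relations, because it acts on column values whereas each
    relation only permutes two adjacent positions.

    On the signed product [(-q)^(-l(R)-l(R')) [U,R_ord][L,R'_ord]] of
    complementary minors, [T_z] acts by the same rule: if [z] and [z + 1] lie in
    the same tuple, the product is an eigenvector for [-q^-1], which is what the
    rule says since swapping [z] and [z + 1] changes [l(R) + l(R')] by one and
    [(-q)^-2 = 1 - (q^-1 - q)(-q)^-1].

    At the top of the tower the columns of the upper minor all lie to the right
    of those of the lower one, so the two minors commute entry by entry.  Going
    down the tower, [T_z] turns the identity for [I_(s-1)] into the identity for
    [I_s], and the recursion defining the lists [C_i] is the expansion of
    [T_z]. *)

Set Implicit Arguments.
Unset Strict Implicit.
Unset Printing Implicit Defensive.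

Import GRing.Theory.

(** * Adjacent transpositions and inversions *)

Lemma swapK z : involutive (swap z).
Proof. by move=> a; rewrite /swap; do !case: eqP => //; lia. Qed.

Lemma swap_inj z : injective (swap z).
Proof. exact: inv_inj (swapK z). Qed.

(** No integer lies strictly between [z] and [z.+1], so exchanging them can reverse the order of
    that pair only. *)
Lemma swap_lt z j l : j < l -> ~~ ((j == z) && (l == z.+1)) ->
  swap z j < swap z l.
Proof. by rewrite /swap; do !case: eqP => //=; lia. Qed.

Lemma swap_lt_mono z a b : ~~ ((a == z) && (b == z.+1)) ->
  ~~ ((a == z.+1) && (b == z)) -> (swap z a < swap z b) = (a < b).
Proof. by rewrite /swap; do !case: eqP => //=; lia. Qed.

Lemma ninv_map (f : nat -> nat) (S : seq nat) :
  {in S &, {mono f : a b / a < b}} -> ninv (map f S) = ninv S.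
Proof.
move=> fS; rewrite /ninv size_map; apply: eq_big_nat => b /andP[_ bS].
apply: eq_big_nat => a /andP[_ ab]; have aS := ltn_trans ab bS.
by rewrite !(nth_map 0) // fS // mem_nth.
Qed.

Lemma ninv_sorted (S : seq nat) : sorted ltn S -> ninv S = 0.
Proof.
move=> Ss; rewrite /ninv big_nat big1 // => b /andP[_ bS].
rewrite big_nat big1 // => a /andP[_ ab].
have := sorted_ltn_nth ltn_trans 0 Ss a b; rewrite !inE.
by move=> /(_ (ltn_trans ab bS) bS ab); case: ltnP => //; lia.
Qed.

Lemma ninv_swap z (w : seq nat) : uniq w -> z.+1 \in w ->
  index z w < index z.+1 w -> ninv (map (swap z) w) = (ninv w).+1.
Proof.
move=> Uw z1w ii; set i := index z w; set j := index z.+1 w.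
have jw : j < size w by rewrite index_mem.
have zw : z \in w by rewrite -index_mem; apply: ltn_trans jw.
(* [d] marks the one pair of positions, those of [z] and [z.+1], whose relative order the swap
   changes. *)
pose d a b := (a == i) && (b == j).
transitivity (\sum_(0 <= b < size w) \sum_(0 <= a < b)
   ((nth 0 w b < nth 0 w a) + d a b)).
  rewrite /ninv size_map; apply: eq_big_nat => b /andP[_ bS].
  apply: eq_big_nat => a /andP[_ ab]; have aS := ltn_trans ab bS.
  rewrite !(nth_map 0) //.
  have ia : (nth 0 w a == z) = (a == i).
    by rewrite -(nth_index 0 zw) nth_uniq // index_mem.
  have ja : (nth 0 w a == z.+1) = (a == j).
    by rewrite -(nth_index 0 z1w) nth_uniq // index_mem.
  have ib : (nth 0 w b == z) = (b == i).
    by rewrite -(nth_index 0 zw) nth_uniq // index_mem.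
  have jb : (nth 0 w b == z.+1) = (b == j).
    by rewrite -(nth_index 0 z1w) nth_uniq // index_mem.
  have [dab|dab] := boolP (d a b).
    have /andP[ai bj] := dab; rewrite -ia -jb in ai bj.
    by rewrite (eqP ai) (eqP bj) /swap eqxx gtn_eqF // eqxx ltnSn; lia.
  rewrite addn0 swap_lt_mono ?ia ?ja ?ib ?jb //; last by rewrite andbC.
  by apply/negP=> /andP[/eqP bi /eqP aj]; move: ab ii; rewrite bi aj /i /j; lia.
under eq_bigr do rewrite big_split /=; rewrite big_split /= -addn1; congr (_ + _).
rewrite (bigD1_seq j) ?mem_index_iota ?iota_uniq //= [X in _ + X]big1 ?addn0.
  rewrite (bigD1_seq i) ?mem_index_iota ?iota_uniq //= /d !eqxx big1 // => a.
  by move=> /negPf->.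
by move=> b /negPf bj; rewrite big1 // => a _; rewrite /d bj andbF.
Qed.

Lemma index_map_swap z (w : seq nat) a : index (swap z a) (map (swap z) w) = index a w.
Proof. exact: index_map (@swap_inj z) _ _. Qed.

Lemma swapL z : swap z z = z.+1. Proof. by rewrite /swap eqxx. Qed.
Lemma swapR z : swap z z.+1 = z. Proof. by rewrite /swap gtn_eqF // eqxx. Qed.

Lemma map_swapK z : involutive (map (swap z)).
Proof. by move=> w; rewrite mapK //; exact: swapK. Qed.

Lemma ninv_swap_gt z (w : seq nat) : uniq w -> z \in w ->
  index z.+1 w < index z w -> ninv w = (ninv (map (swap z) w)).+1.
Proof.
move=> Uw zw ii; rewrite -[in LHS](map_swapK z w); apply: ninv_swap.
- by rewrite map_inj_uniq //; exact: swap_inj.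
- by rewrite -[z.+1]swapL map_f.
- by rewrite -{1}[z]swapR -{2}[z.+1]swapL !index_map_swap.
Qed.

Lemma ninv_swap_notin z (w : seq nat) : (z \notin w) || (z.+1 \notin w) ->
  ninv (map (swap z) w) = ninv w.
Proof.
move=> zw; apply: ninv_map => a b aw bw; apply: swap_lt_mono.
  apply/negP => /andP[/eqP az /eqP bz].
  by case/orP: zw => /negP[]; rewrite -?bz // -az.
apply/negP => /andP[/eqP az /eqP bz].
by case/orP: zw => /negP[]; rewrite -?az // -bz.
Qed.

(** This subword records at once whether [z] and [z.+1] occur exactly once each and in which
    order. *)
Definition adj z (b : seq nat) := [seq c <- b | (c == z) || (c == z.+1)].

Lemma adj_cat z b c : adj z (b ++ c) = adj z b ++ adj z c.
Proof. exact: filter_cat. Qed.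

Lemma adj2_swap z j l : j < l -> ~~ ((j == z) && (l == z.+1)) ->
  adj z [:: l; j] = adj z [:: j; l].
Proof.
rewrite /adj /= => jl jlz; case: ifP => //; case: ifP => // h h'.
by exfalso; move: jl jlz h h'; lia.
Qed.

Lemma adj_uniq z (w : seq nat) : uniq w -> z \in w -> z.+1 \in w ->
  adj z w = if index z w < index z.+1 w then [:: z; z.+1] else [:: z.+1; z].
Proof.
elim: w => //= a w IH /andP[aw Uw]; rewrite !inE !(eq_sym _ a) /adj /=.
have [az|az] := eqVneq a z; have [az1|az1] := eqVneq a z.+1.
- by move: az1; rewrite az => /eqP; rewrite ltn_eqF.
- move=> _ /= z1w; congr (_ :: _) => //.
  rewrite -(filter_pred1_uniq Uw z1w); apply: eq_in_filter => c cw /=.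
  by rewrite (_ : c == z = false) //; apply: contraNF aw; rewrite az => /eqP<-.
- move=> /= zw _; congr (_ :: _) => //; rewrite -(filter_pred1_uniq Uw zw).
  apply: eq_in_filter => c cw /=; rewrite orbC (_ : c == z.+1 = false) //.
  by apply: contraNF aw; rewrite az1 => /eqP<-.
- by move=> /= zw z1w; rewrite ltnS; exact: IH.
Qed.

Local Open Scope ring_scope.

(** * The Hecke operator on words *)

Section Words.
Variables (K : comUnitRingType) (A : algType K) (t : K) (y : nat -> nat -> A).
Hypothesis y_row : forall i j l, (j < l)%N ->
  y i j * y i l = t^-1 *: (y i l * y i j).
Hypothesis y_col : forall i j l, (j < l)%N ->
  y j i * y l i = t^-1 *: (y l i * y j i).
Hypothesis y_comm : forall i j a l, (i < a)%N -> (l < j)%N ->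
  y i j * y a l = y a l * y i j.
Hypothesis y_cross : forall i j a l, (i < a)%N -> (j < l)%N ->
  y i j * y a l = y a l * y i j + (t^-1 - t) *: (y a j * y i l).

Definition word (W : seq (nat * nat)) : A := \prod_(p <- W) y p.1 p.2.

Definition swap_col z (p : nat * nat) := (p.1, swap z p.2).

(* Both coefficients vanish, and the value is [0], on the words in which [z] and
   [z + 1] do not occur exactly once each. *)
Definition hecke z (W : seq (nat * nat)) : A :=
  let s := adj z (map snd W) in
  (s \in [:: [:: z; z.+1]; [:: z.+1; z]])%:R *: word (map (swap_col z) W)
    - ((s == [:: z.+1; z])%:R * (t^-1 - t)) *: word W.

Lemma word_cat V W : word (V ++ W) = word V * word W.
Proof. by rewrite /word big_cat. Qed.

Lemma word2 p p' : word [:: p; p'] = y p.1 p.2 * y p'.1 p'.2.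
Proof. by rewrite /word big_cons big_seq1. Qed.

Lemma adj_nil z W : adj z (map snd W) = [::] -> map (swap_col z) W = W.
Proof.
move=> W0; rewrite -[RHS]map_id; apply/eq_in_map => -[i j] ijW /=.
have : j \notin adj z (map snd W) by rewrite W0.
rewrite mem_filter (map_f snd ijW) andbT /swap_col /swap /=.
by case: eqP => // _; case: eqP.
Qed.

(** [M] already has two columns among [z] and [z.+1]. A further one in [P] or [S] makes both
    coefficients vanish; without one, the swap fixes [P] and [S]. *)
Lemma hecke_ctx z P M S : size (adj z (map snd M)) = 2 ->
  hecke z (P ++ M ++ S) =
  (nilp (adj z (map snd P)) && nilp (adj z (map snd S)))%:R *:
    (word P * hecke z M * word S).
Proof.
move=> M2; rewrite /hecke !map_cat !adj_cat.
case: (boolP (nilp _ && _)) => [/andP[/nilP P0 /nilP S0]|PS].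
  rewrite P0 S0 /= cats0 (adj_nil P0) (adj_nil S0) !word_cat scale1r.
  set c := (_ * (t^-1 - t)); by rewrite mulrBr mulrBl -!(scalerAr, scalerAl) !mulrA.
rewrite scale0r; set s := _ ++ _.
have : size s != 2 by rewrite /s !size_cat M2; move: PS; rewrite /nilp; lia.
by case: s => [|a [|b [|c s]]] //= _;
  rewrite ?inE ?eqseq_cons /= ?andbF mul0r !scale0r subrr.
Qed.

(** The coefficients depend on [M] only through [s]. When the words of a relation share the same
    [s], the relation can be applied separately to the swapped words and to the original ones. *)
Lemma hecke_gen z P M S s : adj z (map snd M) = s ->
  let c := adj z (map snd P) ++ s ++ adj z (map snd S) in
  hecke z (P ++ M ++ S) =
    (c \in [:: [:: z; z.+1]; [:: z.+1; z]])%:R *: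
      (word (map (swap_col z) P) * word (map (swap_col z) M)
        * word (map (swap_col z) S))
    - ((c == [:: z.+1; z])%:R * (t^-1 - t)) *: (word P * word M * word S).
Proof.
by move=> <- /=; rewrite /hecke !map_cat !adj_cat !word_cat !mulrA.
Qed.

Let eqzS z : (z == z.+1) = false. Proof. exact: ltn_eqF. Qed.
Let eqSz z : (z.+1 == z) = false. Proof. exact: gtn_eqF. Qed.

Lemma hecke_pair z i a : hecke z [:: (i, z); (a, z.+1)] = y i z.+1 * y a z.
Proof.
rewrite /hecke /adj /= !eqxx orbT inE eqxx /= !eqseq_cons eqzS /=.
by rewrite mul0r scale0r subr0 scale1r word2 /= /swap eqxx eqSz eqxx.
Qed.

Lemma hecke_pairr z i a : hecke z [:: (i, z.+1); (a, z)] =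
  y i z * y a z.+1 - (t^-1 - t) *: (y i z.+1 * y a z).
Proof.
rewrite /hecke /adj /= !eqxx orbT !inE eqxx /= orbT.
by rewrite mul1r scale1r !word2 /= /swap eqxx eqSz eqxx.
Qed.

Let adj_pair z i a : size (adj z (map snd [:: (i : nat, z); (a : nat, z.+1)])) = 2.
Proof. by rewrite /adj /= !eqxx orbT. Qed.
Let adj_pairr z i a : size (adj z (map snd [:: (i : nat, z.+1); (a : nat, z)])) = 2.
Proof. by rewrite /adj /= !eqxx orbT. Qed.

(** If the columns are [z] and [z.+1], the descending pair is multiplied by [t^-1 - (t^-1 - t) = t],
    which cancels the factor [t^-1]. Any other pair keeps its order under the swap, so [y_row]
    applies to both kinds of words. *)
Lemma hecke_row z i j l P S : t \is a GRing.unit -> (j < l)%N ->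
  hecke z (P ++ [:: (i, j); (i, l)] ++ S)
    = t^-1 *: hecke z (P ++ [:: (i, l); (i, j)] ++ S).
Proof.
move=> t_unit jl; have [/andP[/eqP jz /eqP lz]|jlz] := boolP ((j == z) && (l == z.+1)).
  subst j l; rewrite !hecke_ctx // hecke_pair hecke_pairr (y_row i jl).
  rewrite scalerA mulrC -scalerA; congr (_ *: _).
  rewrite scalerAl scalerAr; congr (_ * _ * _).
  rewrite -scalerBl scalerA -[LHS]scale1r; congr (_ *: _).
  by rewrite opprB addrC subrK mulVr.
rewrite (@hecke_gen z P [:: (i, j); (_, l)] S _ erefl).
rewrite (@hecke_gen z P [:: (i, l); (i, j)] S _ (adj2_swap jl jlz)).
rewrite /= !word2 /= (y_row i jl) (y_row i (swap_lt jl jlz)).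
rewrite scalerBr -!(scalerAr, scalerAl) !scalerA.
by rewrite ![t^-1 * _]mulrC.
Qed.

(** Both letters have the same column, hence still a common one after the swap, and [y_col] applies
    before and after it. *)
Lemma hecke_col z i j l P S : (j < l)%N ->
  hecke z (P ++ [:: (j, i); (l, i)] ++ S)
    = t^-1 *: hecke z (P ++ [:: (l, i); (j, i)] ++ S).
Proof.
move=> jl; rewrite (@hecke_gen z P [:: (j, i); (l, i)] S _ erefl)
  (@hecke_gen z P [:: (l, i); (j, i)] S _ erefl).
rewrite /= !word2 /= !(y_col _ jl).
rewrite scalerBr -!(scalerAr, scalerAl) !scalerA.
by rewrite ![t^-1 * _]mulrC.
Qed.

(** For the columns [z.+1], [z] the swap turns the commuting pair into a crossing one; the extra
    term of [y_cross] is exactly what the correction in [hecke] removes. *)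
Lemma hecke_comm z i j a l P S : (i < a)%N -> (l < j)%N ->
  hecke z (P ++ [:: (i, j); (a, l)] ++ S)
    = hecke z (P ++ [:: (a, l); (i, j)] ++ S).
Proof.
move=> ia lj; have [/andP[/eqP lz /eqP jz]|jlz] := boolP ((l == z) && (j == z.+1)).
  subst j l; rewrite !hecke_ctx // hecke_pair hecke_pairr (y_cross ia (ltnSn z)).
  by rewrite (y_comm ia (ltnSn z)) addrK.
rewrite (@hecke_gen z P [:: (i, j); (a, l)] S _ (adj2_swap lj jlz)).
rewrite (@hecke_gen z P [:: (a, l); (i, j)] S _ erefl).
by rewrite /= !word2 /= (y_comm ia lj) (y_comm ia (swap_lt lj jlz)).
Qed.

(** Conversely, for the columns [z], [z.+1] the swap turns the crossing pair into a commuting one,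
    and the two terms with [t^-1 - t] on the right cancel each other. *)
Lemma hecke_cross z i j a l P S : (i < a)%N -> (j < l)%N ->
  hecke z (P ++ [:: (i, j); (a, l)] ++ S)
    = hecke z (P ++ [:: (a, l); (i, j)] ++ S)
      + (t^-1 - t) *: hecke z (P ++ [:: (a, j); (i, l)] ++ S).
Proof.
move=> ia jl; have [/andP[/eqP jz /eqP lz]|jlz] := boolP ((j == z) && (l == z.+1)).
  subst j l; rewrite !hecke_ctx // !hecke_pair hecke_pairr.
  rewrite (y_comm ia (ltnSn z)); set c := _%:R.
  rewrite [_ *: (c *: _)]scalerA [_ * c]mulrC -[(c * _) *: _]scalerA -scalerDr.
  congr (c *: _).
  by rewrite [X in _ + X]scalerAl [_ *: (word P * _)]scalerAr -mulrDl -mulrDr subrK.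
rewrite (@hecke_gen z P [:: (i, j); (_, l)] S _ erefl).
rewrite (@hecke_gen z P [:: (a, l); (i, j)] S _ (adj2_swap jl jlz)).
rewrite (@hecke_gen z P [:: (a, j); (i, l)] S _ erefl).
rewrite /= !word2 /= (y_cross ia jl) (y_cross ia (swap_lt jl jlz)).
rewrite !mulrDr !mulrDl !scalerDr opprD.
rewrite -!(scalerAr, scalerAl) scalerN !scalerA addrACA.
by congr (_ + _); congr (_ *: _ - _ *: _); rewrite mulrC.
Qed.

End Words.

(** * The Hecke operator on the quantum matrix algebra *)

Local Open Scope quotient_scope.

Lemma mmap_in_algZ (M : choiceType) (K : nzRingType) (A : lalgType K)
    (h : M -> A) (c : K) (u : {malg K[M]}) :
  mmap (in_alg A) h (c *: u) = c *: mmap (in_alg A) h u.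
Proof.
rewrite (mmapEw (msuppZ_le c u)) mmapE scaler_sumr; apply: eq_bigr => m _.
by rewrite mcoeffZ /= !mulr_algl scalerA.
Qed.

Lemma mmap_in_algU (M : choiceType) (K : nzRingType) (A : lalgType K)
    (h : M -> A) (c : K) (m : M) :
  mmap (in_alg A) h << c *g m >> = c *: h m.
Proof. by rewrite mmapU /= mulr_algl. Qed.

(** By additivity it suffices to test monomial factors on both sides; this is how a map is shown to
    vanish on a two-sided ideal. *)
Lemma malg_sandwich0 (M : monomType) (K : nzRingType) (V : zmodType)
    (f : {malg K[M]} -> V) (r : {malg K[M]}) :
  {morph f : u v / u + v} ->
  (forall a m b m', f (<< a *g m >> * r * << b *g m' >>) = 0) ->
  forall u v, f (u * r * v) = 0.
Proof.
move=> fD fr u v; have f0 : f 0 = 0.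
  by apply: (addrI (f 0)); rewrite -fD !addr0.
rewrite (monalgE u) -mulrA mulr_suml (big_morph f fD f0) big1 // => m _.
by rewrite mulrA (monalgE v) mulr_sumr (big_morph f fD f0) big1.
Qed.

Lemma malg_sandwichU (M : monomType) (K : nzRingType) (a b : K) (m m1 m2 m' : M) :
  << a *g m >> * (<< m1 >> * << m2 >>) * << b *g m' >> =
  << (a * b) *g mmul (mmul m (mmul m1 m2)) m' >> :> {malg K[M]}.
Proof. by rewrite !malgM_def !fgmulUU !mulr1. Qed.

Lemma malg_sandwichB (M : monomType) (K : nzRingType) (V : zmodType)
    (f : {malg K[M]} -> V) (u v : {malg K[M]}) :
  {morph f : w w' / w - w'} -> {morph (fun w => f (u * w * v)) : w w' / w - w'}.
Proof. by move=> fB w w'; rewrite mulrBr mulrBl fB. Qed.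

Lemma malg_sandwichZ (M : monomType) (K : comNzRingType) (V : lmodType K)
    (f : {malg K[M]} -> V) (u v : {malg K[M]}) :
  (forall c, {morph f : w / c *: w}) ->
  forall c, {morph (fun w => f (u * w * v)) : w / c *: w}.
Proof. by move=> fZ c w; rewrite -malg_scaleAr -scalerAl fZ. Qed.

(** [F] is meant to be the Hecke rule applied to an element placed between two monomials, [G] its
    value when that element is a two-letter word, and [d] the product of the coefficients of the two
    monomials. *)
Lemma relator_eq0 (k : fieldType) (n : nat) (A : lalgType (kq k))
    (X : idx n -> idx n -> A) (V : lmodType (kq k)) (F : A -> V)
    (G : seq (nat * nat) -> V) (d : kq k) :
  {morph F : w w' / w - w'} -> (forall c, {morph F : w / c *: w}) ->
  (forall i j a l, F (X i j * X a l) = d *: G [:: (val i, val j);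
    (val a, val l)]) ->
  (forall i j l, (j < l)%N -> G [:: (i, j); (i, l)] = q^-1 *: G [:: (i, l);
    (i, j)]) ->
  (forall i j l, (j < l)%N -> G [:: (j, i); (l, i)] = q^-1 *: G [:: (l, i);
    (j, i)]) ->
  (forall i j a l, (i < a)%N -> (l < j)%N ->
     G [:: (i, j); (a, l)] = G [:: (a, l); (i, j)]) ->
  (forall i j a l, (i < a)%N -> (j < l)%N -> G [:: (i, j); (a, l)] =
     G [:: (a, l); (i, j)] + (q^-1 - q) *: G [:: (a, j); (i, l)]) ->
  forall r, relator X r -> F r = 0.
Proof.
move=> FB FZ FX Grow Gcol Gcomm Gcross r.
case=> [i j l jl|i j l jl|i j c l icjl|i j c l ic jl]; rewrite ?FB ?FZ !FX.
- by rewrite Grow // !scalerA mulrC subrr.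
- by rewrite Gcol // !scalerA mulrC subrr.
- by case/orP: icjl => /andP[ic jl]; rewrite (Gcomm _ _ _ _ ic jl) subrr.
- by rewrite Gcross // scalerDr [X in X - _]addrAC subrr add0r !scalerA mulrC subrr.
Qed.

Section HeckeOperator.
Variables (k : fieldType) (n : nat).
Local Notation O := (OqM k n).
Local Notation x := (x k n).
Local Notation pi := (\pi_(presented (relator1 k n))).

Lemma piZ c (u : freeM k n) : pi (c *: u) = c *: (pi u : O).
Proof. exact: pi_prZ. Qed.

Lemma piM (u v : freeM k n) : pi (u * v) = (pi u : O) * pi v.
Proof. exact: pi_prM. Qed.

Lemma piD (u v : freeM k n) : pi (u + v) = (pi u : O) + pi v.
Proof. exact: raddfD. Qed.

Lemma piB (u v : freeM k n) : pi (u - v) = (pi u : O) - pi v.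
Proof. exact: raddfB. Qed.

Lemma pi_eq0 (u : freeM k n) :
  (pi u = 0 :> O) <-> u \in gen_ideal (relator (@X k n)).
Proof.
have := pr_equiv (relator1 k n) u 0; rewrite subr0 raddf0 => <-.
by split=> /eqP.
Qed.

Lemma pi_rel (u : freeM k n) : relator (@X k n) u -> pi u = 0 :> O.
Proof. by move=> ru; apply/pi_eq0/gen_ideal_rel. Qed.

Lemma xE (i j : idx n) : x (val i) (val j) = pi (X k i j).
Proof. by rewrite /Defs.x !valK. Qed.

(** A generator with an index outside [1..n] is 0, so this relation and the next three hold for all
    natural numbers, as the study of words assumes. *)
Lemma x_row i j l : (j < l)%N -> x i j * x i l = q^-1 *: (x i l * x i j).
Proof.
move=> jl; rewrite /Defs.x; case: insubP => [a _ ia|_];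
  last by rewrite !mul0r scaler0.
case: insubP => [b _ jb|_]; last by rewrite mul0r mulr0 scaler0.
case: insubP => [c _ lc|_]; last by rewrite mul0r mulr0 scaler0.
apply/eqP; rewrite -subr_eq0 -!piM -piZ -piB; apply/eqP/pi_rel.
by apply: rel_row; rewrite jb lc.
Qed.

Lemma x_col i j l : (j < l)%N -> x j i * x l i = q^-1 *: (x l i * x j i).
Proof.
move=> jl; rewrite /Defs.x; case: (insubP _ i) => [a _ ia|_]; last first.
  by case: insubP => *; rewrite mul0r ?mulr0 scaler0.
case: insubP => [b _ jb|_]; last by rewrite mul0r mulr0 scaler0.
case: insubP => [c _ lc|_]; last by rewrite mul0r mulr0 scaler0.
apply/eqP; rewrite -subr_eq0 -!piM -piZ -piB; apply/eqP/pi_rel.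
by apply: rel_col; rewrite jb lc.
Qed.

Lemma x_comm i j a l : (i < a)%N -> (l < j)%N -> x i j * x a l = x a l * x i j.
Proof.
move=> ia lj; rewrite /Defs.x.
case: insubP => [i' _ ii|_]; last by rewrite mul0r mulr0.
case: insubP => [j' _ jj|_]; last by rewrite mul0r mulr0.
case: insubP => [a' _ aa|_]; last by rewrite mul0r mulr0.
case: insubP => [l' _ ll|_]; last by rewrite mul0r mulr0.
apply/eqP; rewrite -subr_eq0 -!piM -piB; apply/eqP/pi_rel.
by apply: rel_comm; rewrite ii jj aa ll ia lj.
Qed.

Lemma x_cross i j a l : (i < a)%N -> (j < l)%N ->
  x i j * x a l = x a l * x i j + (q^-1 - q) *: (x a j * x i l).
Proof.
move=> ia jl; rewrite /Defs.x.
case: (insubP _ i) => [i' _ ii|_]; last first.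
  by rewrite mul0r !mulr0 scaler0 addr0.
case: (insubP _ a) => [a' _ aa|_]; last first.
  by rewrite !mul0r mulr0 scaler0 addr0.
case: (insubP _ j) => [j' _ jj|_]; last first.
  by rewrite !mul0r mulr0 scaler0 addr0.
case: (insubP _ l) => [l' _ ll|_]; last first.
  by rewrite mul0r !mulr0 scaler0 addr0.
apply/eqP; rewrite -subr_eq0 opprD addrA -!piM -piZ -!piB; apply/eqP/pi_rel.
by apply: rel_cross; rewrite ?ii ?jj ?aa ?ll.
Qed.

Definition letters (s : seq (idx n * idx n)) : seq (nat * nat) :=
  [seq (val p.1, val p.2) | p <- s].

Local Notation heckew z W := (hecke q x z W).

Local Notation monom := {fmonom (idx n * idx n)%type}.

(** The Hecke rule is not multiplicative in the monomial; [mmap] serves only to extend it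
    linearly. *)
Definition hecke_free z (u : freeM k n) : O :=
  mmap (in_alg O) (fun m : monom => heckew z (letters m)) u.

Lemma hecke_freeB z u v :
  hecke_free z (u - v) = hecke_free z u - hecke_free z v.
Proof. exact: mmapB. Qed.

Lemma hecke_freeD z u v :
  hecke_free z (u + v) = hecke_free z u + hecke_free z v.
Proof. exact: mmapD. Qed.

Lemma hecke_free_sum z (I : Type) (r : seq I) (F : I -> freeM k n) :
  hecke_free z (\sum_(i <- r) F i) = \sum_(i <- r) hecke_free z (F i).
Proof. by elim/big_rec2: _ => [|i y1 y2 _ <-];
  [exact: mmap0|exact: hecke_freeD]. Qed.

Lemma hecke_freeU z c (m : monom) :
  hecke_free z << c *g m >> = c *: heckew z (letters m).
Proof. exact: mmap_in_algU. Qed.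

Lemma hecke_freeZ z c (u : freeM k n) :
  hecke_free z (c *: u) = c *: hecke_free z u.
Proof.
exact: mmap_in_algZ.
Qed.

Lemma letters_cat s s' : letters (s ++ s') = letters s ++ letters s'.
Proof. exact: map_cat. Qed.

(** Once the outer factors are monomials, they form the context of a two-letter word, and each kind
    of relator is handled by one of the four compatibility lemmas for words. *)
Lemma hecke_free_rel z u r v : relator (@X k n) r ->
  hecke_free z (u * r * v) = 0.
Proof.
move=> rr; move: u v; apply: (malg_sandwich0 (hecke_freeD z)) => a m b m'.
pose F (w : freeM k n) : O := hecke_free z (<< a *g m >> * w * << b *g m' >>).
have FB (w w' : freeM k n) : F (w - w') = F w - F w'.
  exact: (malg_sandwichB _ _ (hecke_freeB z)).
have FZ c (w : freeM k n) : F (c *: w) = c *: F w.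
  exact: (malg_sandwichZ _ _ (hecke_freeZ z)).
apply: (@relator_eq0 _ _ _ _ _ F (fun M => heckew z (letters m ++ M ++ letters m'))
  (a * b) FB FZ) rr => [i j i' j'|i j l|i j l|i j c l|i j c l].
- apply: etrans (congr1 (hecke_free z) (malg_sandwichU a b m _ _ m')) _.
  by rewrite hecke_freeU !fmM !fmU -catA !letters_cat.
- exact: (hecke_row x_row _ _ _ _ (q_unit k)).
- exact: (hecke_col x_col).
- exact: (hecke_comm x_comm x_cross).
- exact: (hecke_cross x_comm x_cross).
Qed.

Lemma hecke_free_ideal z u : u \in gen_ideal (relator (@X k n)) ->
  hecke_free z u = 0.
Proof.
move=> /asboolP[s [sr ->]]; rewrite hecke_free_sum big_seq big1 // => t /sr.
exact: hecke_free_rel.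
Qed.

Definition hecke_op z (w : O) : O := hecke_free z (repr w).

(** Two representatives differ by an element of the ideal, where [hecke_free] vanishes. *)
Lemma hecke_op_pi z u : hecke_op z (pi u) = hecke_free z u.
Proof.
apply/eqP; rewrite /hecke_op -subr_eq0 -hecke_freeB; apply/eqP.
by apply/hecke_free_ideal; rewrite -(pr_equiv (relator1 k n)) reprK.
Qed.

Lemma hecke_opD z : {morph hecke_op z : u v / u + v}.
Proof.
move=> u v; rewrite -[u]reprK -[v]reprK -piD !hecke_op_pi.
exact: hecke_freeD.
Qed.

Lemma hecke_opZ z c : {morph hecke_op z : u / c *: u}.
Proof.
by move=> u; rewrite -[u]reprK -piZ !hecke_op_pi hecke_freeZ.
Qed.

Definition in_range i := (0 < i <= n)%N.

(** A word with indices in range is the class of a monomial of the free algebra, on which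
    [hecke_free] is the rule itself. *)
Lemma hecke_op_word z W :
  all (fun p => in_range p.1 && in_range p.2) W ->
  hecke_op z (word x W) = heckew z W.
Proof.
move=> Wn; have [s ->] : exists s, W = letters s.
  elim: W Wn => [|[i j] W IH] /=; first by exists [::].
  by case/andP=> /andP[hi hj] /IH[s ->]; exists ((Sub i hi, Sub j hj) :: s).
have -> : word x (letters s) = pi << FMonom s >>.
  elim: s {Wn} => [|p s IH].
    rewrite /word big_nil.
    by rewrite -[FMonom [::]]fmoneE -[1]/(pr_one _) !piE.
  rewrite /word big_cons -/(word _ _) -/(letters _) IH /= !xE -piM.
  congr (pi _); rewrite /X malgM_def fgmulUU mulr1 -surjective_pairing.
  by congr mkmalgU; apply/eqP; rewrite fmP fmM fmU.
by rewrite hecke_op_pi hecke_freeU scale1r.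
Qed.

End HeckeOperator.

Local Close Scope quotient_scope.

(** * Action on products of complementary minors *)

Lemma permutations_map_swap z (R : seq nat) :
  perm_eq (permutations R) (map (map (swap z)) (permutations (map (swap z) R))).
Proof.
apply: uniq_perm; first exact: permutations_uniq.
  rewrite map_inj_uniq ?permutations_uniq //.
  exact: inv_inj (map_swapK z).
move=> w; rewrite -[w in RHS](map_swapK z) mem_map;
  last exact: inv_inj (map_swapK z).
rewrite !mem_permutations; apply/idP/idP; first exact: perm_map.
exact/perm_map_inj/swap_inj.
Qed.

Lemma perm_map_swap z (R : seq nat) : uniq R -> (z \in R) = (z.+1 \in R) ->
  perm_eq (map (swap z) R) R.
Proof.
move=> UR zR; apply: uniq_perm => //.
  by rewrite map_inj_uniq //; exact: swap_inj.
move=> a; rewrite -[a in LHS](swapK z) mem_map; last exact: swap_inj.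
by rewrite /swap; case: eqP => [->|_]; [rewrite zR|case: eqP => [->|]; rewrite ?zR].
Qed.

(** * Quantum minors as sums over arrangements of the columns *)

Section QuantumMinors.
Variables (K : comUnitRingType) (A : algType K) (t : K) (y : nat -> nat -> A).
Hypothesis t_unit : t \is a GRing.unit.

Definition qminor (U B : seq nat) : A :=
  \sum_(s : 'S_(size U)) (- t) ^- ninv (perm_seq s) *:
    \prod_(i < size U) y (nth 0 U i) (nth 0 B (s i)).

(** The sum over permutations of positions becomes a sum over words of column values, the form on
    which an operator acting on values can be evaluated. *)
Lemma qminorE (U B : seq nat) : sorted ltn B -> size B = size U ->
  qminor U B = \sum_(w <- permutations B) (- t) ^- ninv w *: word y (zip U w).
Proof.
move=> sB szB; have UB : uniq B := sorted_uniq ltn_trans ltnn sB.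
pose f (s : 'S_(size U)) := map (nth 0%N B) (perm_seq s).
have fE s : f s = [seq nth 0%N B (s i) | i <- enum 'I_(size U)].
  by rewrite /f /perm_seq -map_comp.
have nthf s (i : 'I_(size U)) : nth 0%N (f s) i = nth 0%N B (s i).
  by rewrite fE (nth_map i) ?size_enum_ord // nth_ord_enum.
have szf s : size (f s) = size U by rewrite fE size_map size_enum_ord.
have finj : injective f.
  move=> s s' ss'; apply/permP => i; apply/val_inj/eqP => /=.
  by rewrite -(nth_uniq 0%N _ _ UB) ?szB // -!nthf ss'.
have fP : perm_eq [seq f s | s <- index_enum 'S_(size U)] (permutations B).
  have Uf : uniq [seq f s | s <- index_enum 'S_(size U)].
    by rewrite map_inj_uniq // index_enum_uniq.
  have sub : {subset [seq f s | s <- index_enum 'S_(size U)] <= permutations B}.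
    move=> _ /mapP[s _ ->]; rewrite mem_permutations; apply: uniq_perm => //.
      rewrite fE map_inj_in_uniq ?enum_uniq // => i j _ _ /eqP.
      by rewrite nth_uniq ?szB // => /eqP/val_inj/perm_inj.
    move=> a; apply/idP/idP => [|aB].
      by rewrite fE => /mapP[i _ ->]; rewrite mem_nth // szB.
    have ia : (index a B < size U)%N by rewrite -szB index_mem.
    rewrite fE; apply/mapP; exists ((s^-1)%g (Ordinal ia));
      first by rewrite mem_enum.
    by rewrite permKV /= nth_index.
  apply: uniq_perm => //; first exact: permutations_uniq.
  (* Both lists have [(size U)!] members, so the injective family [f] exhausts the arrangements of
     [B]. *)
  have le : (size (permutations B) <= size [seq f s | s <- index_enum 'S_(size U)])%N.
    by rewrite size_permutations // size_map szB -card_Sn cardT enumT [index_enum _]unlock.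
  exact: (uniq_min_size Uf sub le).2.
rewrite -(perm_big _ fP) big_map; apply: eq_bigr => s _; congr (_ *: _).
  (* As [B] is increasing, replacing positions by entries keeps every inversion. *)
  congr (_ ^- _); rewrite ninv_map // => a b.
  have Ps c : c \in perm_seq s -> (c < size B)%N.
    by move=> /mapP[i _ ->]; rewrite szB ltn_ord.
  move=> /Ps aB /Ps bB.
  have mono := sorted_ltn_nth ltn_trans 0%N sB.
  case: (ltngtP a b) => ab; last by rewrite ab ltnn.
    by apply: mono.
  by apply/negbTE; rewrite -leqNgt; apply/ltnW/mono.
rewrite /word (big_nth (0, 0)%N) size_zip szf minnn big_mkord.
by apply: eq_bigr => i _; rewrite nth_zip ?szf //= nthf.
Qed.

End QuantumMinors.

Lemma appears_before_split z (w w' : seq nat) :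
  (z \in w) = ~~ (z.+1 \in w) -> appears_before z (w, w') = (z \in w).
Proof.
move=> zw; rewrite /appears_before /= !index_cat zw.
have [z1w|z1w] := boolP (z.+1 \in w) => /=.
  apply/negbTE; rewrite -leqNgt; apply/ltnW/(leq_trans _ (leq_addr _ _)).
  by rewrite index_mem.
by rewrite ltn_addr // index_mem zw z1w.
Qed.

Lemma mem_map_swapL z w : (z \in map (swap z) w) = (z.+1 \in w).
Proof. by rewrite -{1}[z]swapR mem_map //; exact: swap_inj. Qed.

Lemma mem_map_swapR z w : (z.+1 \in map (swap z) w) = (z \in w).
Proof. by rewrite -{1}[z.+1]swapL mem_map //; exact: swap_inj. Qed.

(** Inversions between the two tuples are not counted, in contrast with [ninv (w ++ w')]. *)
Definition ninv2 (w w' : seq nat) := (ninv w + ninv w')%N.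

(** With [z] and [z.+1] in different tuples, the only pair that the swap could reverse is never
    compared. *)
Lemma ninv2_swap_split z (w w' : seq nat) :
  uniq (w ++ w') -> (z \in w) = ~~ (z.+1 \in w) ->
  ninv2 (map (swap z) w) (map (swap z) w') = ninv2 w w'.
Proof.
rewrite cat_uniq => /and3P[_ /hasPn ww' _] zw.
rewrite /ninv2 !ninv_swap_notin //; last by rewrite zw; case: (_ \in w).
have [z1w|z1w] := boolP (z.+1 \in w).
  by rewrite orbC; apply/orP; left; apply/negP => /ww'; rewrite z1w.
by apply/orP; left; apply/negP => /ww'; rewrite zw z1w.
Qed.

(** One tuple holds both [z] and [z.+1], and its inversion number goes up by one if [z] comes first
    and down by one otherwise; the other tuple holds neither. The additive form avoids truncated
    subtraction. *)
Lemma ninv2_swap_same z (w w' : seq nat) :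
  uniq (w ++ w') -> z \in w ++ w' -> z.+1 \in w ++ w' ->
  (z \in w) = (z.+1 \in w) ->
  (ninv2 (map (swap z) w) (map (swap z) w') + ~~ appears_before z (w, w')
   = ninv2 w w' + appears_before z (w, w'))%N.
Proof.
rewrite cat_uniq !mem_cat => /and3P[Uw /hasPn ww' Uw'] + + zw.
have lem v : uniq v -> z \in v -> z.+1 \in v ->
    (ninv (map (swap z) v) + ~~ (index z v < index z.+1 v)
    = ninv v + (index z v < index z.+1 v))%N.
  move=> Uv zv z1v; case: ltngtP => ii.
  - by rewrite ninv_swap // addn0 addn1.
  - by rewrite (ninv_swap_gt Uv zv ii) addn0 addn1.
  - have := congr1 (nth 0%N v) ii; rewrite !nth_index //.
    by move/eqP; rewrite ltn_eqF.
rewrite /ninv2 /appears_before /= !index_cat -zw.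
have [zinw _ _|zinw /= zw' z1w'] := boolP (z \in w).
  have z1inw : z.+1 \in w by rewrite -zw.
  rewrite [ninv (map _ w')]ninv_swap_notin; last first.
    by apply/orP; left; apply/negP => /ww'; rewrite zinw.
  by rewrite addnAC lem // addnAC.
rewrite [ninv (map _ w)]ninv_swap_notin ?zinw //.
by rewrite ltn_add2l -!addnA lem.
Qed.

Lemma map_swap_col_zip z (U w : seq nat) :
  map (swap_col z) (zip U w) = zip U (map (swap z) w).
Proof. by elim: U w => [|a U IH] [|b w] //=; rewrite IH. Qed.

Section HeckeAction.
Variables (K : comUnitRingType) (A : algType K) (t : K) (y : nat -> nat -> A).
Hypothesis t_unit : t \is a GRing.unit.
Variables (n : nat) (U L : seq nat).

Local Notation wordUL w w' := (word y (zip U w ++ zip L w')).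

(** The signed product of minors expanded into words. The range of summation depends only on the
    entries of [R] and [R'], so their order matters only in the sign and no sorting is required. *)
Definition minor_prod (R R' : seq nat) : A :=
  \sum_(w <- permutations R) \sum_(w' <- permutations R')
    (- t) ^- (ninv2 R R' + ninv2 w w') *: wordUL w w'.

Lemma hecke_word2 z w w' : size w = size U -> size w' = size L ->
  uniq (w ++ w') -> z \in w ++ w' -> z.+1 \in w ++ w' ->
  hecke t y z (zip U w ++ zip L w') =
    wordUL (map (swap z) w) (map (swap z) w')
      - ((~~ appears_before z (w, w'))%:R * (t^-1 - t)) *: wordUL w w'.
Proof.
move=> sw sw' Uww zw z1w; rewrite /hecke map_cat.
rewrite -[map snd _]/(unzip2 _) -[map snd (zip L _)]/(unzip2 _).
rewrite !unzip2_zip ?sw ?sw' // adj_uniq // map_cat !map_swap_col_zip.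
rewrite /appears_before /=; case: ifP => _ /=.
  by rewrite inE eqxx scale1r eqseq_cons ltn_eqF.
by rewrite !inE eqxx orbT scale1r.
Qed.

(** The Hecke quadratic relation [e ^+ 2 = 1 - (t^-1 - t) * e] for the eigenvalue [e = - t^-1],
    multiplied by [e ^+ m]. *)
Lemma quadratic_expr m :
  (- t) ^- m.+2 = (- t) ^- m - (t^-1 - t) * (- t) ^- m.+1.
Proof.
rewrite -!exprVn invrN 2!exprS.
have tt : t * t^-1 = 1 by rewrite mulrV.
set e := _ ^+ m; rewrite [X in _ = X](_ : _ =
  e - t * t^-1 * e + - t^-1 * (- t^-1 * e)); last by ring.
by rewrite tt mul1r subrr add0r.
Qed.

(** Both sides equal [(- t) ^- (p + m).+1], directly or by [quadratic_expr], whatever the orders [b]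
    and [bR]. Here [m], [m'] are the inversion numbers of a word before and after the swap, and [p],
    [p'] those of [(R, R')]. *)
Lemma minor_prod_coef (b bR : bool) (m m' p p' : nat) :
  (m' + ~~ b = m + b)%N -> (p' + ~~ bR = p + bR)%N ->
  (- t) ^- (p + m') - (~~ b)%:R * (t^-1 - t) * (- t) ^- (p + m) =
  (- t) ^- (p' + m) - (~~ bR)%:R * (t^-1 - t) * (- t) ^- (p + m).
Proof.
case: b; case: bR; rewrite /= !(mulr0n, mulr1n, mul0r, mul1r, subr0, addn0, addn1).
- by move=> -> ->; rewrite addSn addnS.
- by move=> -> <-; rewrite addSn addnS quadratic_expr addSn.
- by move=> <- ->; rewrite addSn addnS quadratic_expr.
- by move=> <- <-; rewrite !(addnS, addSn).
Qed.

Variables (z : nat) (T : A -> A).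
Hypothesis TD : {morph T : u v / u + v}.
Hypothesis TZ : forall c, {morph T : u / c *: u}.
Hypothesis T_word : forall w w', perm_eq (w ++ w') (iota 1 n) ->
  size w = size U -> size w' = size L ->
  T (wordUL w w') = hecke t y z (zip U w ++ zip L w').
Hypothesis z_range : (0 < z < n)%N.

Lemma T_minor_prod R R' : perm_eq (R ++ R') (iota 1 n) ->
  size R = size U -> size R' = size L ->
  T (minor_prod R R') = minor_prod (map (swap z) R) (map (swap z) R')
    - ((~~ appears_before z (R, R'))%:R * (t^-1 - t)) *: minor_prod R R'.
Proof.
move=> RR sR sR'.
have T0 : T 0 = 0 by apply: (addrI (T 0)); rewrite -TD !addr0.
have in_zn w w' : perm_eq (w ++ w') (iota 1 n) ->
    [/\ uniq (w ++ w'), z \in w ++ w' & z.+1 \in w ++ w'].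
  move=> ww; rewrite (perm_uniq ww) !(perm_mem ww) iota_uniq !mem_iota.
  by split=> //; move: z_range; lia.
have permW w w' : w \in permutations R -> w' \in permutations R' ->
    perm_eq (w ++ w') (iota 1 n).
  by rewrite !mem_permutations => wR wR'; apply: perm_trans RR; exact: perm_cat.
have [URR zR z1R] := in_zn _ _ RR.
pose C (w w' : seq nat) : K := (- t) ^- (ninv2 R R' + ninv2 w w').
have -> : T (minor_prod R R') =
    \sum_(w <- permutations R) \sum_(w' <- permutations R')
      C w w' *: wordUL (map (swap z) w) (map (swap z) w')
  - \sum_(w <- permutations R) \sum_(w' <- permutations R')
      ((~~ appears_before z (w, w'))%:R * (t^-1 - t) * C w w') *: wordUL w w'.
  rewrite /minor_prod (big_morph T TD T0) -sumrB; apply: eq_big_seq => w wR.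
  rewrite (big_morph T TD T0) -sumrB; apply: eq_big_seq => w' wR'.
  have ww := permW _ _ wR wR'; have [Uww zw z1w] := in_zn _ _ ww.
  move: wR wR'; rewrite !mem_permutations => /perm_size wR /perm_size wR'.
  rewrite TZ T_word ?wR ?wR' // hecke_word2 ?wR ?wR' // scalerBr scalerA.
  by rewrite [C w w' * _]mulrC.
(* Reindexing by the swapped words, so that both sides can be compared word by word. *)
have -> : \sum_(w <- permutations R) \sum_(w' <- permutations R')
      C w w' *: wordUL (map (swap z) w) (map (swap z) w') =
    \sum_(u <- permutations (map (swap z) R))
      \sum_(u' <- permutations (map (swap z) R'))
        C (map (swap z) u) (map (swap z) u') *: wordUL u u'.
  rewrite (perm_big _ (permutations_map_swap z R)) big_map; apply: eq_bigr => u _.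
  rewrite (perm_big _ (permutations_map_swap z R')) big_map; apply: eq_bigr => u' _.
  by rewrite !map_swapK.
have UR : uniq R by move: URR; rewrite cat_uniq => /andP[].
have UR' : uniq R' by move: URR; rewrite cat_uniq => /and3P[].
rewrite /minor_prod.
(* If [z] and [z.+1] lie in different tuples, the swapped sums and the corrections agree
   separately. *)
have [zz|zz] := eqVneq (z \in R) (z.+1 \in R); last first.
  have {}zz : (z \in R) = ~~ (z.+1 \in R) by move: zz; do 2!case: (_ \in R).
  congr (_ - _).
    apply: eq_big_seq => u; rewrite mem_permutations => uR.
    apply: eq_big_seq => u'; rewrite mem_permutations => uR'.
    have Uuu : uniq (u ++ u').
      rewrite (perm_uniq (perm_cat uR uR')) -map_cat map_inj_uniq //.
      exact: swap_inj.
    have zu : (z \in u) = ~~ (z.+1 \in u).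
      by rewrite !(perm_mem uR) mem_map_swapL mem_map_swapR zz negbK.
    by rewrite /C (ninv2_swap_split Uuu zu) (ninv2_swap_split URR zz).
  rewrite scaler_sumr; apply: eq_big_seq => w; rewrite mem_permutations => wR.
  rewrite scaler_sumr; apply: eq_big_seq => w' _; rewrite scalerA /C.
  by rewrite !appears_before_split // !(perm_mem wR).
have zz' : (z \in R') = (z.+1 \in R').
  move: URR zR z1R; rewrite cat_uniq !mem_cat -zz => /and3P[_ /hasPn RR' _].
  have [zinR _ _|_ /= -> -> //] := boolP (z \in R).
  rewrite [LHS](negbTE (contraL (RR' z) _)) ?zinR //.
  by rewrite [RHS](negbTE (contraL (RR' z.+1) _)) ?zinR // -zz.
(* Otherwise the swap permutes the entries of each tuple, all four sums run over the same words, and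
   the coefficients of a single word remain to be compared. *)
have pR := perm_map_swap UR zz; have pR' := perm_map_swap UR' zz'.
rewrite !(perm_big _ (perm_permutations pR)) -!sumrB scaler_sumr -sumrB.
apply: eq_big_seq => w wR.
rewrite !(perm_big _ (perm_permutations pR')) scaler_sumr -!sumrB.
apply: eq_big_seq => w' wR'; rewrite scalerA -!scalerBl; congr (_ *: _).
have [Uww zw z1w] := in_zn _ _ (permW _ _ wR wR').
apply: minor_prod_coef; apply: ninv2_swap_same => //.
by move: wR; rewrite mem_permutations => wR; rewrite !(perm_mem wR).
Qed.

End HeckeAction.

(** * The standard column tower *)

Lemma sumn_map_swap z J :
  (sumn (map (swap z) J) + count_mem z.+1 J = sumn J + count_mem z J)%N.
Proof. by elim: J => //= a J; rewrite /swap; do 2!case: eqP; lia. Qed.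

Lemma sorted_ltn_complement n J : sorted ltn (complement n J).
Proof. exact: sorted_filter ltn_trans _ _ (iota_ltn_sorted 1 n). Qed.

Lemma mem_complement n J a :
  (a \in complement n J) = (0 < a <= n)%N && (a \notin J).
Proof. by rewrite mem_filter mem_iota add1n ltnS andbC. Qed.

Lemma increasing_uniq n J : increasing_in n J -> uniq J.
Proof. by case/andP => sJ _; exact: (sorted_uniq ltn_trans ltnn sJ). Qed.

Lemma perm_cat_complement n J : increasing_in n J ->
  perm_eq (J ++ complement n J) (iota 1 n).
Proof.
move=> incJ; have UJ := increasing_uniq incJ.
apply: uniq_perm; rewrite ?iota_uniq //.
  rewrite cat_uniq UJ filter_uniq ?iota_uniq // andbT.
  by apply/hasPn => a; rewrite mem_complement => /andP[].
case/andP: incJ => _ /allP JP a.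
rewrite mem_cat mem_complement mem_iota add1n ltnS.
by have [aJ|_] := boolP (a \in J); rewrite ?(JP _ aJ) ?andbT.
Qed.

Lemma size_complement n J : increasing_in n J ->
  size (complement n J) = (n - size J)%N.
Proof.
by move/perm_cat_complement/perm_size; rewrite size_cat size_iota => h;
  rewrite -[n in RHS]h addKn.
Qed.

Lemma sorted_map_swap z J : (z \notin J) || (z.+1 \notin J) ->
  sorted ltn J -> sorted ltn (map (swap z) J).
Proof.
move=> zJ; rewrite sorted_map; apply: sub_in_sorted (allss J) => a b aJ bJ /= ab.
apply: swap_lt => //; apply/negP => /andP[/eqP az /eqP bz].
by case/orP: zJ => /negP[]; rewrite -?bz // -az.
Qed.

Lemma col_stepE n J (z := col_entry n J) : increasing_in n J ->
  J != top_tuple n (size J) ->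
  [/\ increasing_in n (col_step n J), z \in J, z.+1 \notin J, (0 < z < n)%N &
      complement n J = map (swap z) (complement n (col_step n J))].
Proof.
move=> incJ Jtop; have [incJ1 sJ1] := col_stepP incJ Jtop.
have UJ := increasing_uniq incJ.
(* A step of the tower raises the sum of the entries by one, which forces [z] to be in [J] and
   [z.+1] not to be. *)
have := sumn_map_swap z J; rewrite -/(col_step n J) sJ1 !count_uniq_mem //.
have [zJ|zJ] := boolP (z \in J); have [z1J|z1J] := boolP (z.+1 \in J);
  rewrite /=; try lia.
move=> _; have zn : (0 < z < n)%N.
  case/andP: incJ => _ /allP /(_ _ zJ) /andP[-> _] /=.
  case/andP: incJ1 => _ /allP /(_ z.+1) /(_ _) /andP[] //.
  by rewrite mem_map_swapR.
split=> //; apply: (irr_sorted_eq ltn_trans ltnn).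
- exact: sorted_ltn_complement.
- apply: sorted_map_swap (sorted_ltn_complement _ _).
  by rewrite orbC !mem_complement mem_map_swapR zJ andbF.
move=> a; rewrite -[a in RHS](swapK z) mem_map; last exact: swap_inj.
rewrite !mem_complement mem_map; last exact: swap_inj.
by congr (_ && _); rewrite /swap; do !case: eqP; lia.
Qed.

Lemma Clist_gt n s J i : (s < i)%N -> Clist n s J i = [::].
Proof. by case: s => [|s] /=; [case: i|move=> ->]. Qed.

(** At index 0 the filtered part is empty, and each swap carries the single pair one level down the
    tower. *)
Lemma Clist0 n s J : increasing_in n J ->
  iter s (col_step n) J = top_tuple n (size J) ->
  (forall m, (m < s)%N -> iter m (col_step n) J <> top_tuple n (size J)) ->
  Clist n s J 0 = [:: (J, complement n J)].
Proof.
elim: s J => [//|s IH] J incJ top_s top_lt.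
have Jtop : J != top_tuple n (size J) by apply/eqP; exact: (top_lt 0%N).
have [incJ1 zJ z1J zn cJ] := col_stepE incJ Jtop.
rewrite /= IH //.
- by rewrite /= /col_step map_swapK -cJ.
- by rewrite -iterSr top_s size_map.
- by move=> m ms; rewrite -iterSr size_map; exact: top_lt.
Qed.

Lemma Clist_perm n s J i RR : increasing_in n J ->
  iter s (col_step n) J = top_tuple n (size J) ->
  (forall m, (m < s)%N -> iter m (col_step n) J <> top_tuple n (size J)) ->
  RR \in Clist n s J i ->
  size RR.1 = size J /\ perm_eq (RR.1 ++ RR.2) (iota 1 n).
Proof.
elim: s J i RR => [|s IH] J i RR incJ top_s top_lt.
  by case: i => //=; rewrite inE => /eqP -> /=; split=> //;
    exact: perm_cat_complement.
have Jtop : J != top_tuple n (size J) by apply/eqP; exact: (top_lt 0%N).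
have [incJ1 zJ z1J zn cJ] := col_stepE incJ Jtop.
have {}IH i' RR' : RR' \in Clist n s (col_step n J) i' ->
    size RR'.1 = size J /\ perm_eq (RR'.1 ++ RR'.2) (iota 1 n).
  move=> RRC; rewrite -[size J](size_map (swap (col_entry n J))).
  apply: IH RRC => //; first by rewrite -iterSr top_s size_map.
  by move=> m ms; rewrite -iterSr size_map; exact: top_lt.
rewrite /=; case: ifP => // _; rewrite mem_cat => /orP[].
  by case: i => // i; rewrite mem_filter => /andP[_ /IH].
case/mapP=> RR' /IH[sz pRR] -> /=; split; first by rewrite size_map.
rewrite -map_cat; apply: perm_trans (perm_map _ pRR) _.
apply: perm_map_swap (iota_uniq 1 n) _.
by rewrite !mem_iota; move: zn; lia.
Qed.

(** * Induction along the tower *)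

Section Tower.
Variables (K : comUnitRingType) (A : algType K) (t : K) (y : nat -> nat -> A).
Hypothesis t_unit : t \is a GRing.unit.
Hypothesis y_comm : forall i j a l, (i < a)%N -> (l < j)%N ->
  y i j * y a l = y a l * y i j.
Variables (n : nat) (T : nat -> A -> A).
Hypothesis TD : forall z, {morph T z : u v / u + v}.
Hypothesis TZ : forall z c, {morph T z : u / c *: u}.
Hypothesis T_word : forall z W,
  all (fun p => (0 < p.1 <= n)%N && (0 < p.2 <= n)%N) W ->
  T z (word y W) = hecke t y z W.
Variable r : nat.
Hypothesis rn : (r <= n)%N.
Let U := iota 1 r.
Let L := iota r.+1 (n - r).

Lemma all_zip_range (V w : seq nat) : {subset V <= iota 1 n} ->
  {subset w <= iota 1 n} ->
  all (fun p => (0 < p.1 <= n)%N && (0 < p.2 <= n)%N) (zip V w).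
Proof.
elim: V w => [|a V IH] [|b w] //= Vn wn.
rewrite IH => [|c cV|c cw].
- have := Vn a (mem_head _ _); have := wn b (mem_head _ _).
  by rewrite !mem_iota !add1n !ltnS => -> ->.
- by apply: Vn; rewrite inE cV orbT.
- by apply: wn; rewrite inE cw orbT.
Qed.

Let Usub : {subset U <= iota 1 n}.
Proof. by move=> a; rewrite !mem_iota; move: rn; lia. Qed.

Let Lsub : {subset L <= iota 1 n}.
Proof. by move=> a; rewrite !mem_iota; move: rn; lia. Qed.

Lemma T_word2 z (V V' w w' : seq nat) : {subset V <= iota 1 n} ->
  {subset V' <= iota 1 n} -> perm_eq (w ++ w') (iota 1 n) ->
  T z (word y (zip V w ++ zip V' w')) = hecke t y z (zip V w ++ zip V' w').
Proof.
move=> Vn Vn' ww; apply: T_word; rewrite all_cat.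
by apply/andP; split; apply: all_zip_range => // a aw;
  rewrite -(perm_mem ww) mem_cat aw ?orbT.
Qed.

Lemma word_comm P S :
  (forall p p', p \in P -> p' \in S -> (p.1 < p'.1)%N && (p'.2 < p.2)%N) ->
  word y (P ++ S) = word y (S ++ P).
Proof.
move=> PS; rewrite !word_cat; elim: P PS => [|p P IH] PS.
  by rewrite /word big_nil mul1r mulr1.
have yS : y p.1 p.2 * word y S = word y S * y p.1 p.2.
  rewrite /word big_seq; elim/big_rec: _ => [|p' v p'S IHv].
    by rewrite mul1r mulr1.
  have /andP[pp pp'] := PS p p' (mem_head _ _) p'S.
  by rewrite mulrA (y_comm pp pp') -mulrA IHv mulrA.
rewrite [word y (p :: P)]big_cons -/(word y P) -mulrA IH => [|a b aP bS].
  by rewrite mulrA yS mulrA.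
by apply: PS => //; rewrite inE aP orbT.
Qed.

Local Notation mprod := (minor_prod t y).

Lemma zip_mem (V w : seq nat) p : p \in zip V w -> (p.1 \in V) && (p.2 \in w).
Proof.
elim: V w => [|a V IH] [|b w] //=; rewrite inE => /orP[/eqP-> /=|/IH /andP[Vp wp]].
  by rewrite !mem_head.
by rewrite !inE Vp wp !orbT.
Qed.

(** The letters from [U] have smaller rows and larger columns than those from [L], so [y_comm] moves
    them past each other; the sign is symmetric in the two words. *)
Lemma tower_base (J := top_tuple n r) :
  mprod L U (complement n J) J = mprod U L J (complement n J).
Proof.
rewrite /minor_prod exchange_big; apply: eq_big_seq => w.
rewrite mem_permutations => wJ; apply: eq_big_seq => w'.
rewrite mem_permutations => w'J.
congr (_ ^- _ *: _); first by rewrite /ninv2; lia.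
apply/esym/word_comm => p p' /zip_mem/andP[pU pw] /zip_mem/andP[pL pw'].
move: pU pL; rewrite !mem_iota => pU pL.
move: pw pw'; rewrite (perm_mem wJ) (perm_mem w'J) mem_complement /J /top_tuple !mem_iota.
by clear -rn pU pL; move: p.1 p.2 p'.1 p'.2 pU pL => a b c d; lia.
Qed.

(** A correction term coming from [C i] carries one more factor [- lam], so it belongs to the level
    [i.+1], next to the swapped members of [C i.+1]. *)
Lemma sum_swap_step (V : lmodType K) (lam : K) (F : seq nat * seq nat ->
  V) (s : nat)
    (C : nat -> seq (seq nat * seq nat)) (f : seq nat * seq nat ->
      seq nat * seq nat)
    (P : pred (seq nat * seq nat)) : C s.+1 = [::] ->
  \sum_(0 <= i < s.+1) (- lam) ^+ i *:
    \sum_(RR <- C i) (F (f RR) - ((P RR)%:R * lam) *: F RR) =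
  \sum_(0 <= i < s.+2) (- lam) ^+ i *:
    \sum_(RR <- (if i is i'.+1 then [seq RR <- C i' | P RR] else [::])
              ++ [seq f RR | RR <- C i]) F RR.
Proof.
move=> Cs; under [RHS]eq_bigr do rewrite big_cat /= scalerDr.
(* The kept members form a sum shifted by one, with empty part at level 0; the swapped members
   contribute nothing at the last level, since [C s.+1] is empty. *)
rewrite [RHS]big_split /= [X in _ = X + _]big_nat_recl // big_nil scaler0 add0r.
rewrite [X in _ = _ + X]big_nat_recr //= Cs big_nil scaler0 addr0 addrC.
rewrite -big_split; apply: eq_bigr => i _ /=.
rewrite sumrB scalerBr big_map; congr (_ + _).
rewrite big_filter exprS mulNr scaleNr [lam * _]mulrC -[(_ * lam) *: _]scalerA.
congr (- (_ *: _)).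
rewrite scaler_sumr
  [RHS]big_mkcond; apply: eq_bigr => RR _.
by case: (P RR); rewrite ?mul1r ?mul0r ?scale0r.
Qed.

Lemma tower s J : increasing_in n J -> size J = r ->
  iter s (col_step n) J = top_tuple n r ->
  (forall m, (m < s)%N -> iter m (col_step n) J <> top_tuple n r) ->
  mprod L U (complement n J) J =
  \sum_(0 <= i < s.+1) (- (t^-1 - t)) ^+ i *:
    \sum_(RR <- Clist n s J i) mprod U L RR.1 RR.2.
Proof.
elim: s J => [|s IH] J incJ sJ top_s top_lt.
  rewrite big_nat1 expr0 scale1r /= big_seq1 /=.
  by move: top_s => /= ->; exact: tower_base.
have Jtop : J != top_tuple n (size J) by apply/eqP; rewrite sJ; exact: (top_lt 0%N).
have [incJ1 zJ z1J zn cJ] := col_stepE incJ Jtop.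
set z := col_entry n J in zJ z1J zn cJ; set J1 := col_step n J in incJ1 cJ.
have sJ1 : size J1 = r by rewrite size_map.
have top_s1 : iter s (col_step n) J1 = top_tuple n r by rewrite -iterSr.
have top_lt1 m : (m < s)%N -> iter m (col_step n) J1 <> top_tuple n r.
  by move=> ms; rewrite -iterSr; exact: top_lt.
have /(congr1 (T z)) := IH J1 incJ1 sJ1 top_s1 top_lt1.
have pJ1 := perm_cat_complement incJ1.
have sL : size L = (n - r)%N by rewrite size_iota.
have sU : size U = r by rewrite size_iota.
have JJ : map (swap z) J1 = J by rewrite map_swapK.
have T0 : T z 0 = 0 by apply: (addrI (T z 0)); rewrite -TD !addr0.
have TwLU w w' : perm_eq (w ++ w') (iota 1 n) -> size w = size L ->
  size w' = size U ->
    T z (word y (zip L w ++ zip U w')) = hecke t y z (zip L w ++ zip U w').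
  by move=> ww _ _; exact: T_word2.
have TwUL w w' : perm_eq (w ++ w') (iota 1 n) -> size w = size U ->
  size w' = size L ->
    T z (word y (zip U w ++ zip L w')) = hecke t y z (zip U w ++ zip L w').
  by move=> ww _ _; exact: T_word2.
rewrite (T_minor_prod t_unit (TD z) (TZ z) TwLU zn);
  rewrite ?sL ?sU ?sJ1 ?size_complement ?sJ1 // 1?perm_catC //.
(* On the left no correction arises: the minor on [complement n J1] is the first factor and [z] is
   among its columns, while [z.+1] is in [J1]. *)
rewrite -cJ JJ appears_before_split; last first.
  by rewrite !mem_complement !mem_map_swapL !mem_map_swapR z1J zJ andbF;
    move: zn; lia.
rewrite mem_complement mem_map_swapL z1J (_ : (0 < z <= n)%N)
  ?mul0r ?scale0r ?subr0; last first.
  by move: zn; lia.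
move=> ->; rewrite (big_morph (T z) (TD z) T0).
(* On the right, [Clist_perm] ensures that every pair is complementary, so the rule for [T z]
   applies termwise. *)
transitivity (\sum_(0 <= i < s.+1) (- (t^-1 - t)) ^+ i *:
  \sum_(RR <- Clist n s J1 i) (mprod U L (map (swap z) RR.1) (map (swap z) RR.2)
    - ((~~ appears_before z RR)%:R * (t^-1 - t)) *: mprod U L RR.1 RR.2)).
  apply: eq_bigr => i _; rewrite TZ (big_morph (T z) (TD z) T0); congr (_ *: _).
  apply: eq_big_seq => RR RRC.
  have := Clist_perm incJ1 _ _ RRC; rewrite sJ1 => /(_ top_s1 top_lt1)[sR pR].
  have sR' : size RR.2 = (n - r)%N.
    by move: (perm_size pR); rewrite size_cat sR size_iota => <-; rewrite addKn.
  by rewrite (T_minor_prod t_unit (TD z) (TZ z) TwUL zn) ?sL ?sU // -surjective_pairing.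
rewrite (@sum_swap_step _ _ (fun RR => mprod U L RR.1 RR.2) s (Clist n s J1)
  (fun RR => (map (swap z) RR.1, map (swap z) RR.2))
  (fun RR => ~~ appears_before z RR) (Clist_gt _ _ (ltnSn s))).
apply: eq_big_nat => i /andP[_ si].
by rewrite /= ltnNge -ltnS si.
Qed.

End Tower.

(** * Return to quantum minors and the commutation relation *)

Lemma minor_prodE (K : comUnitRingType) (A : algType K) (t : K)
    (y : nat -> nat -> A) (U L R R' : seq nat) :
  uniq R -> uniq R' -> size R = size U -> size R' = size L ->
  minor_prod t y U L R R' =
    (- t) ^- ninv2 R R' *: (qminor t y U (reorder R) * qminor t y L (reorder R')).
Proof.
move=> UR UR' sR sR'.
have ltn_reorder S : uniq S -> sorted ltn (reorder S).
  by move=> US; rewrite ltn_sorted_uniq_leq sort_uniq US sort_sorted //;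
    exact: leq_total.
rewrite !qminorE ?ltn_reorder ?size_sort //.
rewrite !(perm_big _ (perm_permutations (permEl (perm_sort leq _)))).
rewrite mulr_suml scaler_sumr; apply: eq_bigr => w _.
rewrite mulr_sumr scaler_sumr; apply: eq_bigr => w' _.
rewrite word_cat -scalerAl -scalerAr !scalerA; congr (_ *: _).
by rewrite /ninv2 -!exprVn !exprD mulrA.
Qed.

Lemma reorder_sorted S : sorted ltn S -> reorder S = S.
Proof.
by rewrite ltn_sorted_uniq_leq => /andP[_ sS];
  rewrite /reorder sorted_sort //; exact: leq_trans.
Qed.

Lemma Ccol_spec n I i RR : increasing_in n I -> RR \in Ccol n I i ->
  [/\ uniq RR.1, uniq RR.2, size RR.1 = size I, size RR.2 = (n - size I)%N &
      {subset RR.1 ++ RR.2 <= iota 1 n}].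
Proof.
move=> incI; have [top_N top_lt] := intcP incI.
case/(Clist_perm incI top_N top_lt) => sR pR.
have := perm_uniq pR; rewrite iota_uniq cat_uniq => /and3P[-> _ ->].
have s2 : size RR.2 = (n - size I)%N.
  by have := perm_size pR; rewrite size_cat sR size_iota; lia.
by split=> // a; rewrite (perm_mem pR).
Qed.

Lemma increasing_size n I : increasing_in n I -> (size I <= n)%N.
Proof.
move/perm_cat_complement/perm_size; rewrite size_cat size_iota => <-.
exact: leq_addr.
Qed.

(** The row, column and crossing relations enter only through the existence of the operators [T z];
    commuting letters are used directly, at the top of the tower. *)
Theorem qminor_commutation (K : comUnitRingType) (A : algType K) (t : K)
    (y : nat -> nat -> A) (n r : nat) (I : seq nat) (T : nat -> A -> A)
    (U := iota 1 r) (L := iota r.+1 (n - r)) :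
  t \is a GRing.unit ->
  (forall i j a l, (i < a)%N -> (l < j)%N -> y i j * y a l = y a l * y i j) ->
  (forall z, {morph T z : u v / u + v}) ->
  (forall z c, {morph T z : u / c *: u}) ->
  (forall z W, all (fun p => (0 < p.1 <= n)%N && (0 < p.2 <= n)%N) W ->
    T z (word y W) = hecke t y z W) ->
  increasing_in n I -> size I = r ->
  qminor t y L (complement n I) * qminor t y U I =
    qminor t y U I * qminor t y L (complement n I) +
    \sum_(1 <= i < (intc n I).+1) ((-1) ^+ i * (t^-1 - t) ^+ i) *:
      \sum_(RR <- Ccol n I i) (- t) ^- (ninv RR.1 + ninv RR.2) *:
        (qminor t y U (reorder RR.1) * qminor t y L (reorder RR.2)).
Proof.
move=> t_unit y_comm TD TZ T_word incI sizeI.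
have [top_N top_lt] := intcP incI.
have rn : (r <= n)%N by rewrite -sizeI; exact: increasing_size.
have sU : size U = r by rewrite size_iota.
have sL : size L = (n - r)%N by rewrite size_iota.
have sI' : size (complement n I) = (n - r)%N by rewrite size_complement // sizeI.
have UI := increasing_uniq incI.
have srtI : sorted ltn I by case/andP: incI.
have srtI' := sorted_ltn_complement n I.
have UI' : uniq (complement n I) by rewrite filter_uniq ?iota_uniq.
have := tower t_unit y_comm TD TZ T_word rn incI sizeI.
rewrite -sizeI => /(_ _ top_N top_lt); rewrite sizeI -/U -/L.
rewrite minor_prodE ?sL ?sU // /ninv2 !ninv_sorted // !reorder_sorted //.
rewrite expr0 invr1 scale1r => ->.
(* The level 0 consists of the pair [(I, complement n I)] alone and gives the leading term, with
   trivial sign because both tuples are increasing. *)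
rewrite big_ltn // expr0 scale1r [Clist _ _ _ 0](Clist0 incI top_N top_lt) big_seq1.
rewrite minor_prodE ?sL ?sU // /ninv2 !ninv_sorted // !reorder_sorted //.
rewrite expr0 invr1 scale1r; congr (_ + _); apply: eq_bigr => i _.
rewrite [in LHS]exprNn; congr (_ *: _).
rewrite big_seq [RHS]big_seq; apply: eq_bigr => RR /(Ccol_spec incI)[? ? s1 s2 _].
by rewrite minor_prodE ?sL ?sU ?s1 ?s2 ?sizeI.
Qed.

Lemma increasing_reorder n S : uniq S -> {subset S <= iota 1 n} ->
  increasing_in n (reorder S).
Proof.
move=> US Sn; rewrite /increasing_in ltn_sorted_uniq_leq sort_uniq US.
rewrite sort_sorted; last exact: leq_total.
by apply/allP => a; rewrite mem_sort => /Sn; rewrite mem_iota add1n ltnS.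
Qed.

Lemma increasing_iota n a m : (0 < a)%N -> (a + m <= n.+1)%N ->
  increasing_in n (iota a m).
Proof.
move=> a0 amn; rewrite /increasing_in iota_ltn_sorted; apply/allP => b.
by rewrite mem_iota; lia.
Qed.

Lemma subrB_eq0 (V : zmodType) (a b c d : V) :
  a = b + c -> c = d -> a - b - d = 0.
Proof. by move=> -> ->; rewrite [b + d]addrC addrK subrr. Qed.

Lemma value_at0_1 (k : fieldType) : value_at0 (1 : kq k) 1.
Proof. by exists 1; rewrite ?hornerE // tofrac1. Qed.

(** The first entries [1] and [r.+1] decide, unless [r = 0], when the left tuple is empty. *)
Lemma iota_lexi r m : (0 < m)%N ->
  ((iota 1 r : seqlexi nat) < (iota r.+1 m : seqlexi nat))%O.
Proof.
by case: m => // m _; case: r.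
Qed.

(** For [r = n] the tuple [lower] is empty and the strict inequality between the indices fails;
    hence the condition [r < n] for the commutation relation, while the identity is asserted for
    every [r]. *)
Theorem mainTheorem2 (k : fieldType) (n r : nat) (I : seq nat)
    (incI : increasing_in n I) (sizeI : size I = r) :
  let I' := complement n I in
  let N := intc n I in
  let upper := iota 1 r in
  let lower := iota r.+1 (n - r) in
  let coef (i : nat) (RR : seq nat * seq nat) : kq k :=
    (-1) ^+ i * (q^-1 - q) ^+ i * (- q) ^- (ninv RR.1 + ninv RR.2) in
  minor k n lower I' * minor k n upper I =
    minor k n upper I * minor k n lower I' +
    \sum_(1 <= i < N.+1) ((-1) ^+ i * (q^-1 - q) ^+ i) *:
      \sum_(RR <- Ccol n I i) (- q) ^- (ninv RR.1 + ninv RR.2) *: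
        (minor k n upper (reorder RR.1) * minor k n lower (reorder RR.2))
  /\
  ((r < n)%N ->
   commutation_relation n 1 1 (upper, I) (lower, I')
     [seq (coef i RR, ((upper, reorder RR.1), (lower, reorder RR.2)))
        | i <- iota 1 N, RR <- Ccol n I i]).
Proof.
move=> I' N upper lower coef.
have rn : (r <= n)%N by rewrite -sizeI; exact: increasing_size.
have RRP i RR : RR \in Ccol n I i ->
    [/\ uniq RR.1, uniq RR.2, size RR.1 = r, size RR.2 = (n - r)%N &
        {subset RR.1 ++ RR.2 <= iota 1 n}].
  by rewrite -sizeI; exact: Ccol_spec.
have E := qminor_commutation (q_unit k) (@x_comm k n) (@hecke_opD k n)
  (@hecke_opZ k n) (@hecke_op_word k n) incI sizeI.
split; first exact: E.
move=> rltn; split.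
- split; split=> //=.
  + by apply: increasing_iota; lia.
  + by rewrite size_iota.
  + by apply: increasing_iota; lia.
  + apply/andP; split; first exact: sorted_ltn_complement.
    apply/allP => a; rewrite mem_complement.
    by case/andP.
  + by rewrite size_iota size_complement // sizeI.
- have := @iota_lexi r (n - r); rewrite subn_gt0 => /(_ rltn).
  rewrite Order.ProdLexiOrder.ltxi_pair => lt.
  by rewrite (Order.POrderTheory.ltW lt) Order.POrderTheory.lt_geF.
- by split; exact: value_at0_1.
- move=> b /allpairsPdep[i [RR [_ /RRP[U1 U2 s1 s2 sub] ->]]] /=; split.
  + split=> /=; first by apply: increasing_iota; lia.
      by apply: increasing_reorder => // a aR; apply: sub; rewrite mem_cat aR.
    by rewrite size_sort size_iota s1.
  + split=> /=; first by apply: increasing_iota; lia.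
      by apply: increasing_reorder => // a aR; apply: sub; rewrite mem_cat aR orbT.
    by rewrite size_sort size_iota s2.
  + have := @iota_lexi r (n - r); rewrite subn_gt0 => /(_ rltn) lt.
    rewrite Order.ProdLexiOrder.ltxi_pair.
    by rewrite (Order.POrderTheory.ltW lt) Order.POrderTheory.lt_geF.
rewrite /= !scale1r; apply: subrB_eq0 E _.
(* The flat list of terms is regrouped by level, and the scalar of each level is distributed over
   its pairs. *)
rewrite big_allpairs_dep /= /index_iota subn1 /=; apply: eq_bigr => i _.
by rewrite scaler_sumr; apply: eq_bigr => RR _; rewrite scalerA.
Qed.
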